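(* Let $G$ be a $\Delta$-critical graph on $n$ vertices, where $\Delta$ is the maximum degree of $G$. If $\tau(G)\ge 3/2$ and $\Delta\ge n/3$, then $G$ has a 2-factor.
   Context: All graphs are simple, undirected and finite. For a graph $G$, $\Delta=\Delta(G)$ denotes its maximum degree and $\chi'(G)$ its chromatic index (the least number of colors in a proper edge coloring). $G$ is called $\Delta$-critical if $\chi'(G)=\Delta+1$ and $\chi'(H)<\chi'(G)$ for every proper subgraph $H$ of $G$. Let $c(G)$ denote the number of components of $G$. For a real number $t\ge 0$, $G$ is $t$-tough if $|S|\ge t\cdot c(G-S)$ for every $S\subseteq V(G)$ with $c(G-S)\ge 2$. The toughness $\tau(G)$ is the largest real $t$ for which $G$ is $t$-tough, or $\infty$ if $G$ is complete. A 2-factor of $G$ is a spanning 2-regular subgraph. *)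

(* Defs.v *)
From mathcomp Require Import classical_sets reals constructive_ereal ereal.
From mathcomp Require Import all_boot all_order all_algebra.

Set Implicit Arguments.
Unset Strict Implicit.
Unset Printing Implicit Defensive.

Import Order.TTheory GRing.Theory Num.Theory.

(* Finite simple graphs whose vertices are drawn from an ambient finite type.
   The vertex set is a field of its own, so that subgraphs and vertex-deleted
   subgraphs are graphs over the same ambient type. *)
Record sgraph (T : finType) := SGraph {
  vset : {set T};
  edges : {set {set T}};
  edges_wf : [forall e in edges, (#|e| == 2) && (e \subset vset)] }.

Section Graph.
Variable T : finType.
Implicit Types (G H : sgraph T) (S : {set T}).

Definition adj G : rel T := fun x y => [set x; y] \in edges G.

Definition degree G (x : T) : nat := #|[set y | adj G x y]|.

Definition max_degree G : nat := \max_(x in vset G) degree G x.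

(* Colors are assigned to actual edges only: with a coloring of all of {set T},
   an edgeless graph would not be 0-edge-colorable. *)
Definition proper_edge_coloring G k
    (c : {ffun {e : {set T} | e \in edges G} -> 'I_k}) : bool :=
  [forall e, forall f,
     (e != f) ==> (sval e :&: sval f != set0) ==> (c e != c f)].

Definition edge_colorable G k : bool :=
  [exists c : {ffun {e : {set T} | e \in edges G} -> 'I_k},
     proper_edge_coloring c].

Lemma edge_colorable_ex G : exists k, edge_colorable G k.
Proof.
exists #|{: {e : {set T} | e \in edges G}}|; apply/existsP.
exists [ffun e => enum_rank e]; apply/forallP => e; apply/forallP => f.
apply/implyP => nef; apply/implyP => _; rewrite !ffunE.
by apply: contra nef => /eqP /enum_rank_inj ->.
Qed.

Definition chromatic_index G : nat := ex_minn (edge_colorable_ex G).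

Definition subgraph H G : bool :=
  (vset H \subset vset G) && (edges H \subset edges G).

Definition proper_subgraph H G : bool :=
  subgraph H G && ((vset H != vset G) || (edges H != edges G)).

Definition Delta_critical G : Prop :=
  chromatic_index G = (max_degree G).+1 /\
  forall H, proper_subgraph H G -> chromatic_index H < chromatic_index G.

Lemma adj_vset G x y : adj G x y -> (x \in vset G) && (y \in vset G).
Proof.
move=> Gxy; have /forallP/(_ [set x; y])/implyP/(_ Gxy) := edges_wf G.
by rewrite subUset !sub1set => /and3P[_ -> ->].
Qed.

Lemma adj_sym G : symmetric (adj G).
Proof. by move=> x y; rewrite /adj setUC. Qed.

Lemma adj_irrefl G : irreflexive (adj G).
Proof.
move=> x; apply/negP => Gxx.
have /forallP/(_ [set x; x])/implyP/(_ Gxx) := edges_wf G.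
by rewrite cards2 eqxx.
Qed.

Definition del_edges G S : {set {set T}} :=
  [set e in edges G | [disjoint e & S]].

Lemma del_wf G S :
  [forall e in del_edges G S, (#|e| == 2) && (e \subset vset G :\: S)].
Proof.
apply/forallP => e; apply/implyP; rewrite inE => /andP[Ge eS].
have /forallP/(_ e)/implyP/(_ Ge)/andP[-> sub] := edges_wf G.
by rewrite subsetD sub eS.
Qed.

Definition del_vertices G S : sgraph T := SGraph (del_wf G S).

Definition num_components G : nat := n_comp (adj G) (vset G).

Definition complete G : bool :=
  [forall x in vset G, forall y in vset G, (x != y) ==> adj G x y].

Definition two_factor H G : Prop :=
  [/\ subgraph H G, vset H = vset G & {in vset H, forall x, degree H x = 2}].

End Graph.

Section Toughness.
Variables (R : realType) (T : finType).
Implicit Types (G : sgraph T) (S : {set T}) (t : R).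
Local Open Scope ring_scope.

Definition tough G t : Prop :=
  forall S : {set T}, S \subset vset G ->
    (2 <= num_components (del_vertices G S))%N ->
    t * (num_components (del_vertices G S))%:R <= #|S|%:R.

(* The supremum is attained for noncomplete graphs: see toughnessP. *)
Definition toughness G : \bar R :=
  if complete G then +oo%E
  else ereal_sup [set t%:E | t in [set t : R | 0 <= t /\ tough G t]]%classic.

Lemma noncomplete_separator G : ~~ complete G ->
  exists2 S : {set T}, S \subset vset G & (2 <= num_components (del_vertices G S))%N.
Proof.
case/forallPn => x; rewrite negb_imply => /andP[Gx].
case/forallPn => y; rewrite !negb_imply => /and3P[Gy nxy nGxy].
exists (vset G :\: [set x; y]); first exact: subsetDl.
set H := del_vertices _ _.
have HE : vset H = [set x; y].
  apply/setP => z; rewrite !inE.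
  by case: eqVneq => [->|_] /=; [rewrite Gx|case: eqVneq => [->|_] /=; rewrite ?Gy ?andNb].
have nadj u v : adj H u v = false.
  apply/negP => Huv; have := adj_vset Huv; rewrite HE !inE.
  have Guv : adj G u v by move: Huv; rewrite /adj inE => /andP[].
  case/andP => /orP[]/eqP eu /orP[]/eqP ev; subst u v.
  - by rewrite adj_irrefl in Guv.
  - by rewrite Guv in nGxy.
  - by rewrite adj_sym Guv in nGxy.
  - by rewrite adj_irrefl in Guv.
have conn u v : connect (adj H) u v -> u = v.
  by case/connectP => -[|w p] /=; rewrite ?nadj.
have rootE u : fingraph.root (adj H) u = u by rewrite -(conn _ _ (connect_root _ u)).
rewrite /num_components HE /n_comp_mem.
suff <- : #|[set x; y]| = 2%N.
  apply/subset_leq_card/subsetP => u uxy.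
  by move: uxy; rewrite !inE => ->; rewrite andbT /roots rootE.
by rewrite cards2 nxy.
Qed.

Lemma toughnessP G : ~~ complete G ->
  exists t, [/\ toughness G = t%:E, 0 <= t, tough G t &
                forall s, 0 <= s -> tough G s -> s <= t].
Proof.
move=> ncG; rewrite /toughness (negbTE ncG).
set A := [set _ | _ in _]%classic.
have ubS (S : {set T}) : S \subset vset G ->
    (2 <= num_components (del_vertices G S))%N ->
    (ereal_sup A <= (#|S|%:R / (num_components (del_vertices G S))%:R)%:E)%E.
  move=> SG c2; apply: ge_ereal_sup => _ [s [s0 sG] <-]; rewrite lee_fin.
  by rewrite ler_pdivlMr ?ltr0n ?(leq_trans _ c2)//; exact: sG.
have A0 : A 0%:E by exists 0 => //; split => // S _ _; rewrite mul0r.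
have sup0 : (0%:E <= ereal_sup A)%E by exact: ereal_sup_ubound.
have ub s : 0 <= s -> tough G s -> (s%:E <= ereal_sup A)%E.
  by move=> s0 sG; apply: ereal_sup_ubound; exists s.
have [S0 S0G c2] := noncomplete_separator ncG.
have := ubS _ S0G c2.
case: (ereal_sup A) ubS sup0 ub => [t| |] // ubS t0 ub _.
exists t; split => //.
- move=> S SG cS2; have := ubS _ SG cS2; rewrite lee_fin.
  by rewrite ler_pdivlMr ?ltr0n ?(leq_trans _ cS2).
Qed.

End Toughness.

(* Main.v *)
Require Import Defs.
From mathcomp Require Import all_boot all_order all_algebra.
From mathcomp Require Import reals constructive_ereal.
From mathcomp Require Import perm zify ring lra.

(* Let G be a critical graph without a 2-factor. Tutte's theorem gives disjoint
   vertex sets S, Y with Y independent and s + q < t, where s = |S|, t = |Y|,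
   the components of the rest U = V - S - Y send e_C edges to Y, and
   q = \sum_C floor (e_C / 2). For S maximal and then Y minimal the edges between
   Y and U form, for every component C, a matching, and e_C is odd or 0.
   Deleting S and all but one end in C of these edges, for every C, isolates the
   vertices of Y from each other, so toughness gives 3 t <= 2 (s + 2 q), hence
   q >= s + 3; deleting S and Y bounds the number h of odd components by
   3 h <= 2 (s + t).
   Now count t = \sum 1 / deg y over all edges xy with y in Y. By Vizing's
   adjacency lemma the ends x in S contribute at most 1 + 1 / Delta each. An edge
   to an odd component C has deg y >= Delta + 2 - s - |C|, and |V| <= 3 Delta
   leaves room for at most two components of size about Delta - s, so that the
   total stays below t. *)

Set Implicit Arguments.
Unset Strict Implicit.
Unset Printing Implicit Defensive.

Import Order.TTheory GRing.Theory Num.Theory.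

(** * Matchings and the Gallai barrier *)

(** Toughness alone does not refute a barrier: for toughness 2 the deletion isolating Y would give 2
    t <= s + 2 q and contradict s + q < t at once, whereas 3/2 yields only a lower bound on q. The
    remaining room is closed by degrees. The weights 1 / deg y have to add up to less than s + q +
    1. The part from S exceeds s by at most s / Delta, which is below 3/5 because 5 s + 10 <= 3
    Delta; this leaves 2/5 for the odd components. Toughness makes all degrees in Y at least 3, so a
    component with e_C = 2 K + 1 costs at most (2 K + 1) / 3, which its share K of q covers once K
    >= 1. The trouble comes from components with a single edge to Y: they cost up to 1/3 and add
    nothing to q. If there are many of them, they are small on the whole, and a small component
    forces a large degree at its neighbor in Y. *)

Lemma odd_card_involution (V : finType) (f : V -> V) (B : {set V}) :
  (forall x, x \in B -> f x \in B) -> (forall x, x \in B -> f (f x) = x) ->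
  odd #|B| = odd #|[set x in B | f x == x]|.
Proof.
have [n] := ubnP #|B|; elim: n B => // n IHn B ltBn fB fK.
case: (pickP (fun x => (x \in B) && (f x != x))) => [x /andP[Bx nfx]|all_fix].
  set B' := B :\ x :\ f x.
  have Bfx : f x \in B :\ x by rewrite in_setD1 nfx fB.
  have cB : #|B| = #|B'|.+2 by rewrite (cardsD1 x) Bx (cardsD1 (f x) (B :\ x)) Bfx.
  have B'B y : y \in B' -> [/\ y \in B, y != x & y != f x].
    by rewrite !in_setD1 => /and3P[-> -> ->].
  rewrite cB /= negbK IHn; first last.
  - by move=> y /B'B[/fK].
  - move=> y /B'B[By yx yfx]; rewrite !in_setD1 fB // andbT; apply/andP; split.
      by apply: contra yx => /eqP fyx; rewrite -(fK y By) fyx fK.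
    by apply: contra yfx => /eqP fyx; rewrite -fyx fK.
  - by rewrite -ltnS (leq_trans _ ltBn) // cB.
  congr (odd #|pred_of_set _|); apply/setP => y; rewrite !inE.
  have [->|yfx] := eqVneq y (f x).
    by rewrite fK ?Bx //= [x == _]eq_sym (negbTE nfx) ?andbF /=.
  by have [->|] := eqVneq y x; rewrite //= (negbTE nfx) andbF.
congr (odd #|pred_of_set _|); apply/setP => x; rewrite !inE.
by have := all_fix x; case: (x \in B) => //= /negbFE->.
Qed.

Section Gallai.
Variables (V : finType) (e : rel V).
Hypotheses (e_sym : symmetric e) (e_irr : irreflexive e).
Implicit Types (f g : {ffun V -> V}) (A B W : {set V}).

(** A matching is an involution that exchanges matched vertices and fixes the others. Vertices
    outside [B] are fixed too, hence the restriction to [B] in [missed]. *)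
Definition matching B f : bool :=
  [forall x, (f (f x) == x) && ((f x != x) ==> (x \in B) && e x (f x))].

Definition missed B f := [set x in B | f x == x].

Definition idf : {ffun V -> V} := [ffun x => x].

Lemma matching_id B : matching B idf.
Proof. by apply/forallP => x; rewrite !ffunE eqxx. Qed.

Lemma matchingK B f : matching B f -> involutive f.
Proof. by move=> /forallP mf x; have /andP[/eqP] := mf x. Qed.

Lemma matching_moved B f x :
  matching B f -> f x != x -> [/\ x \in B, f x \in B & e x (f x)].
Proof.
move=> mf nfx; have fK := matchingK mf; move/forallP: mf => mf.
have /andP[_ /implyP/(_ nfx)/andP[-> ->]] := mf x.
have /andP[_] := mf (f x); rewrite fK eq_sym nfx => /andP[-> _].
by [].
Qed.

Definition defect B := #|missed B [arg min_(f < idf | matching B f) #|missed B f|]|.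

Definition optimal B f := matching B f && (#|missed B f| == defect B).

Lemma defect_le B f : matching B f -> defect B <= #|missed B f|.
Proof.
by rewrite /defect; case: arg_minnP => [|g _ min_g /min_g //]; exact: matching_id.
Qed.

Lemma ex_optimal B : exists f, optimal B f.
Proof.
rewrite /optimal /defect; case: arg_minnP => [|g mg _]; first exact: matching_id.
by exists g; rewrite mg eqxx.
Qed.

Lemma odd_missed B f : matching B f -> odd #|missed B f| = odd #|B|.
Proof.
move=> mf; rewrite /missed -odd_card_involution // => x Bx.
  by have [->//|/(matching_moved mf)[]] := eqVneq (f x) x.
exact: matchingK mf x.
Qed.

(** Exchange step: the unmatched [x] takes [y], whose former partner becomes unmatched. *)
Definition rematch f x y : {ffun V -> V} :=
  [ffun w => if w == x then y else if w == y then x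
             else if w == f y then w else f w].

Lemma rematch_matching B f x y :
  matching B f -> x \in B -> y \in B -> f x = x -> e x y ->
  matching B (rematch f x y).
Proof.
move=> mf Bx By fx exy; have fK := matchingK mf.
have nyx : y != x by apply: contraTneq exy => ->; rewrite e_irr.
apply/forallP => w; rewrite !ffunE.
have [->|nwx] := eqVneq w x; first by rewrite (negbTE nyx) !eqxx Bx exy implybT.
have [->|nwy] := eqVneq w y; first by rewrite !eqxx By e_sym exy implybT.
have [wfy|nwz] := eqVneq w (f y).
  by rewrite -wfy (negbTE nwx) (negbTE nwy) !eqxx.
have -> : (f w == x) = false by apply: contra_neqF nwx => /eqP fwx; rewrite -(fK w) fwx fx.
have -> : (f w == y) = false by apply: contra_neqF nwz => /eqP <-; rewrite fK.
case: (eqVneq (f w) (f y)) => [fwy|_]; first by rewrite -(fK w) fwy fK eqxx in nwy.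
rewrite fK eqxx /=; apply/implyP => /(matching_moved mf)[-> _ ->] //.
Qed.

Lemma missed_rematch B f x y :
  matching B f -> x \in B -> y \in B -> f x = x -> e x y ->
  missed B (rematch f x y) =
  if f y == y then missed B f :\ x :\ y else f y |: (missed B f :\ x).
Proof.
move=> mf Bx By fx exy; have fK := matchingK mf.
have nyx : y != x by apply: contraTneq exy => ->; rewrite e_irr.
have fyx : f y != x by apply: contra nyx => /eqP fyx; rewrite -(fK y) fyx fx.
have Bfy : f y \in B by have [->//|/(matching_moved mf)[]] := eqVneq (f y) y.
apply/setP => w; rewrite !(inE, ffunE).
case: (eqVneq (f y) y) => fyy; rewrite !(inE, ffunE).
  have [->|nwx] := eqVneq w x; first by rewrite (negbTE nyx) andbF; case: (_ == y).
  have [->|nwy] := eqVneq w y; first by rewrite eq_sym (negbTE nyx) andbF.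
  by rewrite fyy (negbTE nwy).
have [->|nwx] := eqVneq w x.
  by rewrite (negbTE nyx) andbF eq_sym (negbTE fyx).
have [->|nwy] := eqVneq w y.
  by rewrite ![_ == f y]eq_sym (negbTE fyy) [x == y]eq_sym (negbTE nyx) !andbF.
by have [->|//] := eqVneq w (f y); rewrite Bfy eqxx.
Qed.

(** If [y] were unmatched as well, the exchange would miss two vertices fewer than an optimal
    matching does. *)
Lemma rematch_optimal B f x y :
  optimal B f -> x \in B -> y \in B -> f x = x -> e x y ->
  f y != y /\ optimal B (rematch f x y).
Proof.
move=> /andP[mf /eqP df] Bx By fx exy; have mr := rematch_matching mf Bx By fx exy.
have fK := matchingK mf.
have nyx : y != x by apply: contraTneq exy => ->; rewrite e_irr.
have := defect_le mr; rewrite /optimal mr missed_rematch //.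
have mx : x \in missed B f by rewrite inE Bx fx eqxx.
move: df; rewrite (cardsD1 x) mx; case: (eqVneq (f y) y) => [fyy|nfyy] df.
  have my : y \in missed B f :\ x by rewrite !inE nyx By fyy eqxx.
  by move: df; rewrite (cardsD1 y (_ :\ x)) my => <-; lia.
move=> _; split=> //=; rewrite cardsU1 !inE fK [y == _]eq_sym (negbTE nfyy).
by rewrite !andbF /= -df eqxx.
Qed.

(* Gallai's exchange: among optimal [M] missing [u, v] and optimal [N] missing
   [t], a pair sharing the most edges could be made to share one more. *)
Lemma missed_trans B u t v : t \in B ->
  (exists2 N, optimal B N & N t = t) ->
  (forall M, optimal B M -> M u = u -> M t = t -> u = t) ->
  (forall M, optimal B M -> M t = t -> M v = v -> t = v) ->
  forall M, optimal B M -> u \in B -> v \in B -> M u = u -> M v = v -> u = v.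
Proof.
move=> Bt [N0 oN0 N0t] rut rtv M0 oM0 Bu Bv M0u M0v; apply/eqP/negPn/negP => nuv.
pose P (p : {ffun V -> V} * {ffun V -> V}) :=
  [&& optimal B p.1, p.1 u == u, p.1 v == v, optimal B p.2 & p.2 t == t].
pose agree (p : {ffun V -> V} * {ffun V -> V}) :=
  [set x | (p.1 x == p.2 x) && (p.1 x != x)].
have P0 : P (M0, N0) by rewrite /P /= oM0 M0u M0v oN0 N0t !eqxx.
case: (@arg_maxnP _ (M0, N0) P (fun p => #|agree p|) P0) => -[M N].
rewrite /P /= => /and5P[oM /eqP Mu /eqP Mv oN /eqP Nt] max_MN.
have ntu : t != u.
  by apply: contra nuv => /eqP tu; rewrite -tu (rtv M) // tu.
have ntv : t != v.
  by apply: contra nuv => /eqP tv; rewrite (rut M) ?tv.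
have Nu : N u != u by apply: contra ntu => /eqP Nu; rewrite (rut N).
have Nv : N v != v by apply: contra ntv => /eqP Nv; rewrite (rtv N).
have [/andP[mM /eqP dM] /andP[mN /eqP dN]] := (oM, oN).
(* [M] and [N] miss equally many vertices, and [u], [v] are missed by [M] only; so at least two
   vertices are missed by [N] only, and one of them differs from [t]. *)
have [x [Bx Nx Mx nxt]] : exists x, [/\ x \in B, N x = x, M x != x & x != t].
  have sub : [set u; v] \subset missed B M :\: missed B N.
    by rewrite subUset !sub1set !inE Bu Bv Mu Mv !eqxx (negbTE Nu) (negbTE Nv).
  have := subset_leq_card sub; rewrite cards2 nuv => le2.
  have : 1 < #|missed B N :\: missed B M|.
    rewrite (leq_trans le2) // -(leq_add2l #|missed B M :&: missed B N|).
    by rewrite cardsID setIC cardsID dM dN.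
  rewrite (cardsD1 t) => lt1.
  have /card_gt0P[x] : 0 < #|(missed B N :\: missed B M) :\ t|.
    by move: lt1; case: (_ \in _) => [//|/ltnW].
  rewrite !inE => /and3P[nxt nM /andP[Bx /eqP Nx]].
  by exists x; split=> //; move: nM; rewrite Bx.
have [_ By exy] := matching_moved mM Mx.
have [Ny oR] := rematch_optimal oN Bx By Nx exy.
have MK := matchingK mM; have NK := matchingK mN.
have nNyx : N (M x) != x by apply: contra Ny => /eqP Nyx; rewrite -{2}(NK (M x)) Nyx Nx.
have Rt : rematch N x (M x) t = t.
  rewrite ffunE eq_sym (negbTE nxt); case: eqVneq => [tMx|_].
    by rewrite -tMx Nt eqxx in Ny.
  by rewrite Nt; case: eqP.
(* The exchange makes [N] share the edge from [x] to [M x]. The edge of [N] given up at [M x] was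
   not shared, since [M] matches [M x] with [x]. *)
have := max_MN (M, rematch N x (M x)); rewrite /= oM Mu Mv oR Rt !eqxx => /(_ isT).
apply/negP; rewrite -ltnNge; apply: proper_card; apply/properP; split; last first.
  by exists x; rewrite !inE /= ?ffunE ?eqxx ?Mx ?Nx //= (negbTE Mx).
apply/subsetP => w; rewrite !inE /= ffunE => /andP[/eqP MNw Mw].
rewrite Mw andbT; case: (eqVneq w x) => [->|nwx]; first exact: eqxx.
case: (eqVneq w (M x)) => [->|nwMx]; first by rewrite MK.
case: (eqVneq w (N (M x))) => [wNy|_]; last by rewrite MNw.
by case/eqP: nwx; rewrite -(MK w) MNw wNy NK MK.
Qed.

(** The Tutte-Berge bound, with classes of [lab] that are unions of components. For a largest [W]
    whose removal raises the defect by at least [|W|], every remaining vertex is missed by some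
    optimal matching of the rest. Never being missed together is then an equivalence containing
    adjacency. Its classes are odd: an optimal matching that misses one member matches the others
    among themselves. *)
Theorem gallai_barrier A : exists W (lab : V -> V),
  [/\ W \subset A,
      {in A :\: W &, forall x y, e x y -> lab x = lab y} &
      defect A + #|W| <= #|[set l | odd #|[set x in A :\: W | lab x == l]|]|].
Proof.
pose P W := (W \subset A) && (defect A + #|W| <= defect (A :\: W)).
have P0 : P set0 by rewrite /P sub0set cards0 addn0 setD0 leqnn.
case: (@arg_maxnP _ set0 P (fun W => #|W|) P0) => W /andP[sWA dW] maxW.
set B := A :\: W; rewrite -/B in dW.
(* By maximality of [W], deleting [v] does not raise the defect of [B]. An optimal matching of the
   rest thus misses at most one vertex too many in [B], and parity excludes exactly one. *)
have miss v : v \in B -> exists2 N, optimal B N & N v = v.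
  move=> Bv; have /setDP[Av nWv] := Bv.
  have [f /andP[mf /eqP df]] := ex_optimal (B :\ v).
  have lt_d : defect (B :\ v) <= defect A + #|W|.
    rewrite leqNgt; apply/negP => dlt.
    have : P (v |: W).
      rewrite /P subUset sub1set Av sWA cardsU1 nWv setUC -setDDl -/B.
      by rewrite add1n addnS.
    by move/maxW; rewrite cardsU1 nWv add1n /= ltnn.
  have fv : f v = v.
    by apply/eqP/negPn/negP => /(matching_moved mf)[]; rewrite setD11.
  have mBf : matching B f.
    apply/forallP => x; rewrite (matchingK mf) eqxx /=; apply/implyP.
    by case/(matching_moved mf) => /setD1P[_ ->].
  exists f => //; rewrite /optimal mBf /= eqn_leq defect_le // andbT.
  have cm : #|missed B f| = #|missed (B :\ v) f|.+1.
    rewrite (cardsD1 v) inE Bv fv eqxx; congr _.+1.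
    by congr #|pred_of_set _|; apply/setP => x; rewrite !inE andbA.
  have [g /andP[mg /eqP dg]] := ex_optimal B.
  have := odd_missed mBf; rewrite -(odd_missed mg) dg => par.
  have := defect_le mBf; rewrite leq_eqVlt => /orP[/eqP -> //|].
  have le1 : #|missed B f| <= (defect B).+1 by rewrite cm df ltnS (leq_trans lt_d).
  move=> lt; have eq1 : #|missed B f| = (defect B).+1.
    by apply/eqP; rewrite eqn_leq le1.
  by move: par; rewrite eq1 /=; case: odd.
pose r u v := (u == v) || ~~ [exists M, [&& optimal B M, M u == u & M v == v]].
have rP u v : reflect (forall M, optimal B M -> M u = u -> M v = v -> u = v) (r u v).
  apply: (iffP idP) => [/orP[/eqP-> //|/existsPn nM] M oM Mu Mv|H].
    by have := nM M; rewrite oM Mu Mv !eqxx.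
  rewrite /r; case: eqVneq => //= nuv; apply/existsPn => M; apply/negP.
  by case/and3P => oM /eqP Mu /eqP Mv; rewrite (H M) ?eqxx in nuv.
have r_sym u v : r u v -> r v u by move/rP => H; apply/rP => M oM Mv Mu; rewrite (H M).
have r_trans u t v : u \in B -> t \in B -> v \in B -> r u t -> r t v -> r u v.
  move=> Bu Bt Bv /rP rut /rP rtv; apply/rP => M oM Mu Mv.
  exact: (missed_trans Bt (miss t Bt) rut rtv oM Bu Bv).
pose lab u := odflt u [pick v in B | r u v].
have labP u v : u \in B -> v \in B -> (lab u == lab v) = r u v.
  move=> Bu Bv; apply/eqP/idP => [|ruv].
    rewrite /lab; case: pickP => [u' /andP[Bu' ru]|/(_ u)]; last first.
      by rewrite Bu /r eqxx.
    case: pickP => [v' /andP[Bv' rv]|/(_ v)]; last by rewrite Bv /r eqxx.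
    by move=> /= uv; apply: (r_trans _ _ _ Bu Bu' Bv ru); rewrite uv; apply: r_sym.
  rewrite /lab (eq_pick (_ : _ =1 [pred w | (w \in B) && r v w])).
    by case: pickP => [//|/(_ v)]; rewrite /= Bv /r eqxx.
  move=> w /=; case Bw: (w \in B) => //=; apply/idP/idP => [rw|]; last exact: r_trans.
  by apply: (r_trans _ u) => //; exact: r_sym.
have r_e x y : x \in B -> y \in B -> e x y -> r x y.
  move=> Bx By exy; apply/rP => M oM Mx My.
  by have [] := rematch_optimal oM Bx By Mx exy; rewrite My eqxx.
exists W, lab; split=> // [x y Bx By exy|].
  by apply/eqP; rewrite labP //; apply: r_e.
have [f /andP[mf /eqP df]] := ex_optimal B.
have of_ : optimal B f by rewrite /optimal mf df eqxx.
(* The vertices missed by the optimal [f] have pairwise different labels; it remains to see that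
   their classes are odd. *)
apply: leq_trans dW _; rewrite -df -(card_in_imset (f := lab)); last first.
  move=> x y; rewrite [in X in X -> _]inE [in X in _ -> X -> _]inE.
  move=> /andP[Bx /eqP fx] /andP[By /eqP fy].
  by move/eqP; rewrite labP // => /rP/(_ f)->.
apply/subset_leq_card/subsetP => l /imsetP[v mv ->{l}].
have Bv : v \in B by move: mv; rewrite inE => /andP[].
rewrite inE -/B; set K := [set x in B | lab x == lab v].
have [N oN Nv] := miss v Bv; have /andP[mN _] := oN.
have -> : odd #|K| = odd #|[set x in K | N x == x]|.
  apply: odd_card_involution => x; last by move=> _; exact: matchingK mN x.
  rewrite !inE => /andP[/andP[nWx Ax] /eqP lx].
  have [->|/(matching_moved mN)] := eqVneq (N x) x; first by rewrite nWx Ax lx eqxx.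
  case=> Bx BNx exN; have := BNx; rewrite inE => -> /=.
  by rewrite -lx labP // r_sym // r_e.
suff -> : [set x in K | N x == x] = [set v] by rewrite cards1.
apply/setP => x; rewrite !inE; apply/idP/eqP => [|->]; last first.
  by rewrite Nv !eqxx !andbT; move: Bv; rewrite inE.
case/andP => /andP[Bx lx] /eqP Nx.
have Bx' : x \in B by rewrite inE.
by move: lx; rewrite labP // => /rP/(_ N oN Nx Nv).
Qed.

End Gallai.

(** * Tutte's condition for 2-factors *)

Section Barrier.
Variables (T : finType) (L : finType) (e : rel T) (A : {set T}).
Implicit Types (S Y : {set T}) (lab : {ffun T -> L}).

Definition rest S Y := A :\: (S :|: Y).

Definition links S Y lab l :=
  [set p : T * T | [&& p.1 \in Y, p.2 \in rest S Y, e p.1 p.2 & lab p.2 == l]].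

(* For [Y] independent this is Tutte's condition
   [2|S| + \sum_(y in Y) deg_(G - S) y - 2|Y| - h < 0], with the parity of the
   left-hand side divided out. The classes of [lab] are unions of components. *)
Definition barrier S Y lab :=
  [&& S \subset A, Y \subset A, [disjoint S & Y],
      [forall x in Y, forall y in Y, ~~ e x y],
      [forall x in rest S Y, forall y in rest S Y, e x y ==> (lab x == lab y)] &
      #|S| + \sum_l #|links S Y lab l|./2 < #|Y|].

End Barrier.

Section ShrinkBarrier.
Variables (V : finType) (e : rel V) (A : {set V}).
Hypotheses (e_sym : symmetric e) (e_irr : irreflexive e).

Definition odd_labels (B : {set V}) (lab : V -> V) :=
  [set l | odd #|[set x in B | lab x == l]|].

(** Returning [d] to the graph merges it with at most two classes. If both were odd, the merged
    class including [d] is odd again, so at most one odd class is lost. Hence in a smallest barrier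
    each vertex has neighbors in three classes. *)
Lemma shrink_barrier (W : {set V}) lab d l1 l2 : d \in W -> d \in A ->
  {in A :\: W &, forall x y, e x y -> lab x = lab y} ->
  (forall w, w \in A :\: W -> e d w -> (lab w == l1) || (lab w == l2)) ->
  exists lab' : V -> V,
    {in A :\: (W :\ d) &, forall x y, e x y -> lab' x = lab' y} /\
    #|odd_labels (A :\: W) lab| <= #|odd_labels (A :\: (W :\ d)) lab'|.+1.
Proof.
move=> Wd Ad lab_e lab_d.
pose lab' x := if (x == d) || (lab x == l2) then l1 else lab x.
have inB x : (x \in A :\: (W :\ d)) = (x == d) || (x \in A :\: W).
  by rewrite !inE negb_and negbK andb_orl; case: eqVneq => [->|] //=; rewrite Ad.
exists lab'; split=> [x y|].
  rewrite !inB /lab'; have [->|nxd] := eqVneq x d; have [->|nyd] := eqVneq y d => //=.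
  - by move=> _ By /(lab_d _ By); case: (lab y == l2) => //; rewrite orbF => /eqP.
  - move=> Bx _; rewrite e_sym => /(lab_d _ Bx).
    by case: (lab x == l2) => //; rewrite orbF => /eqP.
  - by move=> Bx By /(lab_e _ _ Bx By) ->.
set O := odd_labels _ lab; set O' := odd_labels _ lab'.
have dB : d \notin A :\: W by rewrite inE Wd.
have same l : l != l1 -> l != l2 -> (l \in O) = (l \in O').
  move=> n1 n2; rewrite !inE; congr (odd #|pred_of_set _|); apply/setP => x.
  rewrite inE [RHS]inE inB /lab'; have [->|_] := eqVneq x d => /=.
    by rewrite (negbTE dB) [l1 == _]eq_sym (negbTE n1).
  case: (eqVneq (lab x) l2) => [->|//].
  by rewrite [l1 == _]eq_sym [l2 == _]eq_sym (negbTE n1) (negbTE n2).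
have sub : O \subset O' :|: [set l1; l2].
  apply/subsetP => l Ol; rewrite in_setU in_set2.
  have [|n1] := eqVneq l l1; rewrite ?orbT //.
  by have [|n2] := eqVneq l l2; rewrite ?orbT // -same // Ol.
have [l12|n12] := eqVneq l1 l2.
  have sub' : O \subset l1 |: O' by move: sub; rewrite -l12 setUid setUC.
  by rewrite (leq_trans (subset_leq_card sub')) // cardsU1; case: (_ \in _).
have [O1|nO1] := boolP (l1 \in O); last first.
  have sub' : O \subset l2 |: O'.
    apply/subsetP => l Ol; have /(subsetP sub) := Ol; rewrite !(in_setU, in_set1).
    case: (eqVneq l l1) => [l1E|_]; first by rewrite -l1E Ol in nO1.
    by rewrite orbC.
  by rewrite (leq_trans (subset_leq_card sub')) // cardsU1; case: (_ \in _).
have [O2|nO2] := boolP (l2 \in O); last first.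
  have sub' : O \subset l1 |: O'.
    apply/subsetP => l Ol; have /(subsetP sub) := Ol; rewrite !(in_setU, in_set1).
    case: (eqVneq l l2) => [l2E|_]; first by rewrite -l2E Ol in nO2.
    by rewrite orbF orbC.
  by rewrite (leq_trans (subset_leq_card sub')) // cardsU1; case: (_ \in _).
have O'1 : l1 \in O'.
  have -> : (l1 \in O') = odd (1 + #|[set x in A :\: W | lab x == l1]|
                               + #|[set x in A :\: W | lab x == l2]|).
    rewrite inE -addnA -cardsUI.
    have -> : [set x in A :\: W | lab x == l1] :&: [set x in A :\: W | lab x == l2] = set0.
      apply/setP => x; rewrite !inE; case: (eqVneq (lab x) l1) => [->|_].
        by rewrite (negbTE n12) !andbF.
      by rewrite !andbF.
    rewrite cards0 addn0; set K := _ :|: _.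
    have nKd : d \notin K by rewrite in_setU !in_set Wd.
    have -> : 1 + #|K| = #|d |: K| by rewrite cardsU1 nKd.
    congr (odd #|pred_of_set _|); rewrite /lab'; apply/setP => x; rewrite inE inB !inE.
    have [->|nxd] := eqVneq x d => /=; first by rewrite eqxx.
    by case: (lab x == l2); rewrite ?eqxx; case: (x \in W); case: (x \in A);
       case: (lab x == l1).
  by move: O1 O2; rewrite !oddD !inE => -> ->.
have sub' : O \subset l2 |: O'.
  apply/subsetP => l Ol; have /(subsetP sub) := Ol; rewrite in_setU => /orP[|].
    by rewrite in_setU1 => ->; rewrite orbT.
  by case/set2P => ->; rewrite in_setU1 ?O'1 ?eqxx ?orbT.
by rewrite (leq_trans (subset_leq_card sub')) // cardsU1; case: (_ \in _).
Qed.

End ShrinkBarrier.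

(** * 2-factors as perfect matchings of an auxiliary graph *)

Section TwoFactor.
Variables (T : finType) (e : rel T) (A : {set T}).
Hypotheses (e_sym : symmetric e) (e_irr : irreflexive e).
Hypothesis (e_A : forall x y, e x y -> x \in A).

(* A 2-factor is a perfect matching of the following graph: two copies
   [inl (x, _)] of every vertex, and two halves [inr (x, y)], [inr (y, x)] of
   every edge; a half is joined to the other half and to both copies of its
   own end. Unused edges are those whose halves are matched together. *)
Definition gadget : finType := ((T * bool) + (T * T))%type.

Definition gadget_rel : rel gadget := fun z w =>
  match z, w with
  | inl p, inr d => (p.1 == d.1) && e d.1 d.2
  | inr d, inl p => (p.1 == d.1) && e d.1 d.2
  | inr d, inr d' => [&& d.1 == d'.2, d.2 == d'.1 & e d.1 d.2]
  | inl _, inl _ => false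
  end.

Definition gadget_set : {set gadget} :=
  [set z : gadget | match z with inl p => p.1 \in A | inr d => e d.1 d.2 end].

Lemma gadget_sym : symmetric gadget_rel.
Proof.
case=> [[x i]|[u v]] [[y j]|[u' v']] //=.
by rewrite eq_sym [v == _]eq_sym andbCA; case: eqP => //= ->; case: eqP => //= ->.
Qed.

Lemma gadget_irr : irreflexive gadget_rel.
Proof.
by case=> [[x i]|[u v]] //=; case: eqP => //= ->; rewrite e_irr andbF.
Qed.

(** An edge is kept when its halves are matched to copies of their ends. The halves agree on this,
    since a half not matched to a copy is matched to the other half. The two copies of a vertex give
    degree 2. *)
Lemma perfect_gadget_two_factor (f : {ffun gadget -> gadget}) :
  matching gadget_rel gadget_set f -> missed gadget_set f = set0 ->
  exists F : rel T, [/\ subrel F e, symmetric F &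
    {in A, forall x, #|[set y | F x y]| = 2}].
Proof.
move=> mf miss0; have fK := matchingK mf.
have moved z : z \in gadget_set -> f z != z.
  by move=> Az; apply/negP => fz; have := in_set0 z; rewrite -miss0 inE Az fz.
pose F x y := [exists i, f (inr (x, y)) == inl (x, i)].
have Fe : subrel F e.
  move=> x y /existsP[i /eqP fxy].
  have /(matching_moved mf)[] : f (inr (x, y)) != inr (x, y) by rewrite fxy.
  by rewrite inE.
have Fs x y : F x y -> F y x.
  move=> Fxy; have exy := Fe _ _ Fxy; case/existsP: Fxy => i /eqP fxy.
  have : inr (y, x) \in gadget_set by rewrite inE /= e_sym.
  move/moved/(matching_moved mf) => [_ _].
  case E: (f (inr (y, x))) => [[z j]|[u v]] /=.
    by case/andP => /eqP zy _; apply/existsP; exists j; rewrite E zy.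
  case/and3P => /eqP yv /eqP xu _.
  by have := fK (inr (y, x)); rewrite E -yv -xu fxy.
exists F; split=> // [x y|x Ax]; first by apply/idP/idP; exact: Fs.
have fx i : exists y, f (inl (x, i)) = inr (x, y).
  have : inl (x, i) \in gadget_set by rewrite inE.
  move/moved/(matching_moved mf) => [_ _].
  case E: (f _) => [//|[u v]] /= /andP[/eqP -> _]; by exists v.
have [y1 fy1] := fx true; have [y2 fy2] := fx false.
have -> : [set y | F x y] = [set y1; y2].
  apply/setP => y; rewrite !inE; apply/existsP/orP => [[i /eqP fxy]|].
    have := fK (inr (x, y)); rewrite fxy; case: i {fxy}; rewrite ?fy1 ?fy2 => -[->];
    by [left|right].
  case=> /eqP ->; first by exists true; rewrite -fy1 fK.
  by exists false; rewrite -fy2 fK.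
rewrite cards2; case: eqVneq => // y12; have := fK (inl (x, true)).
by rewrite fy1 y12 -fy2 fK.
Qed.

Section GadgetBarrier.
Variables (W : {set gadget}) (lab : gadget -> gadget).
Let B := gadget_set :\: W.
Hypotheses (sWA : W \subset gadget_set)
  (lab_e : {in B &, forall x y, gadget_rel x y -> lab x = lab y})
  (ltW : #|W| < #|odd_labels B lab|)
  (minW : forall d lab', d \in W ->
     {in gadget_set :\: (W :\ d) &, forall x y, gadget_rel x y -> lab' x = lab' y} ->
     #|odd_labels (gadget_set :\: (W :\ d)) lab'| <= #|W :\ d|).

(** Otherwise [shrink_barrier] returns [d] and the inequality [ltW] survives, against the minimality
    of [W]. *)
Let tight d l1 l2 : d \in W ->
  exists w, [/\ w \in B, gadget_rel d w, lab w != l1 & lab w != l2].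
Proof.
move=> Wd; have Ad := subsetP sWA _ Wd.
case: (pickP (fun w => [&& w \in B, gadget_rel d w, lab w != l1 & lab w != l2])).
  by move=> w /and4P[*]; exists w.
move=> no; have [w Bw edw|lab' [lab'_e le']] :=
    @shrink_barrier _ _ gadget_set gadget_sym W lab d l1 l2 Wd Ad lab_e.
  by have := no w; rewrite Bw edw /= -negb_or => /negbFE.
have := minW Wd lab'_e; move: ltW; rewrite (cardsD1 d W) Wd; rewrite -/B in le'.
by move=> lt le; move: (leq_trans lt le'); rewrite add1n ltnS ltnNge le.
Qed.

Let inB z : z \in gadget_set -> z \notin W -> z \in B.
Proof. by move=> Az Wz; rewrite inE Wz. Qed.

(** The two copies of [v] have the same neighbors. If one copy remained, all remaining neighbors of
    the other would carry its label, against [tight]. *)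
Let twin v i : inl (v, i) \in W -> inl (v, ~~ i) \in W.
Proof.
move=> Wv; apply/negPn/negP => nW.
have Av : v \in A by have := subsetP sWA _ Wv; rewrite inE.
have [[p|d]] := tight (lab (inl (v, ~~ i))) (lab (inl (v, ~~ i))) Wv; first by case.
case=> Bw /= ew /eqP[]; apply: lab_e => //; first by apply: inB => //; rewrite inE.
Qed.

(** A half has only three neighbors and [tight] demands three labels among them, so all three remain
    and lie in different classes. *)
Let dart_in u v : inr (u, v) \in W ->
  [/\ forall i, inl (u, i) \in B, inr (v, u) \in B &
      lab (inl (u, true)) <> lab (inl (u, false))].
Proof.
move=> Wd; have euv : e u v by have := subsetP sWA _ Wd; rewrite inE.
have Au := e_A euv.
have nbr w : gadget_rel (inr (u, v)) w ->
    [\/ w = inl (u, true), w = inl (u, false) | w = inr (v, u)].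
  case: w => [[x []]|[a b]] /=; first by case/andP => /eqP ->; constructor.
    by case/andP => /eqP -> _; constructor 2.
  by case/and3P => /eqP -> /eqP -> _; constructor 3.
have Ad : inr (v, u) \in gadget_set by rewrite inE /= e_sym.
split=> [i||eq12].
- apply: inB; first by rewrite inE.
  apply/negP => Wi.
  have [w [Bw /nbr[] wE]] := tight (lab (inl (u, ~~ i))) (lab (inr (v, u))) Wd; move: Bw.
  + by rewrite wE inE; case: i Wi => [->//|_ _] /=; rewrite eqxx.
  + by rewrite wE inE; case: i Wi => [_ _|->//] /=; rewrite eqxx.
  + by rewrite wE !eqxx.
- apply: inB => //; apply/negP => Wi.
  have [w [Bw /nbr[] wE]] := tight (lab (inl (u, true))) (lab (inl (u, false))) Wd; move: Bw.
  + by rewrite wE !eqxx.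
  + by rewrite wE !eqxx.
  + by rewrite wE inE Wi.
- have [w [Bw /nbr[] wE]] := tight (lab (inl (u, true))) (lab (inr (v, u))) Wd.
  + by rewrite wE !eqxx.
  + by rewrite wE eq12 !eqxx.
  + by rewrite wE !eqxx.
Qed.

Let S := [set v in A | inl (v, true) \in W].
Let Y := [set v in A | (inl (v, true) \notin W) && [forall w, e v w ==> (inr (v, w) \in W)]].
Let U := rest A S Y.
Let labU : {ffun T -> gadget} := [ffun v => lab (inl (v, true))].

Let copy_in v i : v \in A -> (inl (v, i) \in W) = (v \in S).
Proof.
move=> Av; rewrite inE Av /=; apply/idP/idP; case: i => // Wv; first exact: (twin Wv).
by have := twin Wv.
Qed.

(** If one half at [u] is deleted, all are: a surviving half would be adjacent to both copies of
    [u], whose labels differ. *)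
Let dart_inE u v : e u v -> (inr (u, v) \in W) = (u \in Y).
Proof.
move=> euv; apply/idP/idP => [Wd|]; last by rewrite inE => /and3P[_ _ /forallP/(_ v)/implyP->].
have [BI Bd neq] := dart_in Wd; rewrite inE (e_A euv) /=.
have := BI true; rewrite inE => /andP[-> _] /=; apply/forallP => w; apply/implyP => euw.
apply/negPn/negP => nWw.
have Bw : inr (u, w) \in B by apply: inB => //; rewrite inE.
by case: neq; rewrite (lab_e (BI true) Bw) ?(lab_e (BI false) Bw) //= eqxx.
Qed.

Let restE v : v \in U -> [/\ v \in A, v \notin S & v \notin Y].
Proof. by rewrite !inE -/S -/Y => /andP[]; rewrite negb_or => /andP[-> ->] ->. Qed.

Let lab_dart u w i : u \in U -> e u w -> inr (u, w) \in B /\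
   lab (inr (u, w)) = lab (inl (u, i)).
Proof.
case/restE => Au nS nY euw.
have Bd : inr (u, w) \in B by apply: inB; rewrite ?inE ?dart_inE.
split=> //; apply: lab_e => //=; last by rewrite eqxx.
by apply: inB; rewrite ?inE ?copy_in.
Qed.

Let lab_twin u i j : u \in U -> lab (inl (u, i)) = lab (inl (u, j)).
Proof.
move=> Uu; have [Au nS nY] := restE Uu.
have : ~~ [forall w, e u w ==> (inr (u, w) \in W)].
  by apply: contra nY => H; rewrite inE Au H (copy_in true Au) nS.
case/forallPn => w; rewrite negb_imply => /andP[euw _].
by have [_ <-] := lab_dart i Uu euw; have [_ <-] := lab_dart j Uu euw.
Qed.

(** An involution on the class exchanges the copies of a vertex and reverses halves. Halves pointing
    at [Y] stay fixed, their opposites being deleted, and correspond to the links. The classes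
    excluded by the hypothesis are counted separately. *)
Let links_parity l :
  (forall z, z \in B -> lab z = l ->
     match z with inl p => p.1 \notin Y | inr d => ~~ ((d.1 \in S) && (d.2 \in Y)) end) ->
  odd #|[set z in B | lab z == l]| = odd #|links e A S Y labU l|.
Proof.
move=> noZ; pose phi (z : gadget) : gadget :=
  match z with inl p => inl (p.1, ~~ p.2)
             | inr d => if d.2 \in Y then inr d else inr (d.2, d.1) end.
have in_U v i : inl (v, i) \in B -> lab (inl (v, i)) = l -> v \in U.
  move=> Bv lv; have /= nY := noZ _ Bv lv; have := Bv; rewrite in_setD in_set /= => /andP[nW Av].
  by rewrite in_setD in_setU negb_or nY -(copy_in i) // nW Av.
have in_U' u v : inr (u, v) \in B -> lab (inr (u, v)) = l -> v \in Y -> u \in U.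
  move=> Bd ld vY; have /= := noZ _ Bd ld; rewrite vY andbT => nS.
  have := Bd; rewrite in_setD in_set /= => /andP[nW euv].
  by rewrite in_setD in_setU negb_or nS -(dart_inE euv) nW (e_A euv).
rewrite (@odd_card_involution _ phi); first last.
- case=> [[v i]|[u v]]; rewrite inE => /andP[Bz /eqP lz] /=; first by rewrite negbK.
  case: ifP => vY /=; first by rewrite vY.
  have := Bz; rewrite in_setD in_set /= => /andP[nW euv].
  by move: nW; rewrite dart_inE // => /negbTE ->.
- move=> z; rewrite in_set => /andP[Bz /eqP lz]; rewrite in_set.
  case: z Bz lz => [[v i]|[u v]] Bz lz /=.
    have Uv := in_U _ _ Bz lz; have [Av nS nY] := restE Uv.
    rewrite -lz (lab_twin _ i) // eqxx andbT.
    by apply: inB; rewrite ?in_set // copy_in.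
  case: ifP => vY; first by rewrite Bz lz eqxx.
  have := Bz; rewrite in_setD in_set /= => /andP[nW euv].
  have evu : e v u by rewrite e_sym.
  have Bd' : inr (v, u) \in B by apply: inB; rewrite ?in_set ?dart_inE ?vY.
  by rewrite -lz (lab_e Bz Bd') ?eqxx ?andbT //= !eqxx.
congr odd.
rewrite -(card_imset _ (_ : injective (fun p : T * T => inr (p.2, p.1) : gadget))); last first.
  by move=> [a b] [c d] [-> ->].
congr #|pred_of_set _|; apply/setP => z; rewrite in_set [X in X && _]in_set.
apply/idP/imsetP.
  case: z => [[v i]|[u v]] /= /andP[/andP[Bd /eqP lz] /eqP].
    by case=> /eqP; case: i {Bd lz}.
  have := Bd; rewrite in_setD in_set /= => /andP[nW euv].
  case: ifP => vY; last by case=> uv; move: euv; rewrite uv e_irr.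
  move=> _; exists (v, u) => //; have Uu := in_U' _ _ Bd lz vY.
  have [_ lu] := lab_dart true Uu euv.
  by rewrite inE /= vY -/U Uu e_sym euv ffunE -lu lz eqxx.
case=> [[y u]]; rewrite inE /= -/U => /and4P[vY Uu eyu /eqP lu] ->.
rewrite e_sym in eyu; have [Bd ld] := lab_dart true Uu eyu.
rewrite ffunE in lu.
by rewrite /= vY ld lu Bd !eqxx.
Qed.

(** Both sides of [ltW] count the edges between [Y] and [S], which cancel. Writing the number of
    links as the number of classes with oddly many links plus twice the sum of the rounded halves
    leaves twice the required inequality. *)
Lemma gadget_barrier : barrier e A S Y labU.
Proof.
have sSA : S \subset A by apply/subsetP => x; rewrite inE => /andP[].
have sYA : Y \subset A by apply/subsetP => x; rewrite inE => /andP[].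
have dSY : [disjoint S & Y].
  by rewrite disjoint_subset; apply/subsetP => x; rewrite !inE => /andP[-> ->].
have indY : [forall x in Y, forall y in Y, ~~ e x y].
  apply/forall_inP => x Yx; apply/forall_inP => y Yy; apply/negP => exy.
  have := Yx; rewrite -(dart_inE exy) => /dart_in[_].
  by rewrite inE dart_inE 1?e_sym // Yy.
rewrite /barrier sSA sYA dSY indY /=; apply/andP; split.
  apply/forall_inP => x Ux; apply/forall_inP => y Uy; apply/implyP => exy.
  rewrite !ffunE; have [Bx <-] := lab_dart true Ux exy.
  have eyx : e y x by rewrite e_sym.
  have [By <-] := lab_dart true Uy eyx; apply/eqP; apply: lab_e => //=.
  by rewrite !eqxx.
pose E1 := [set p : T * T | [&& p.1 \in Y, p.2 \in S & e p.1 p.2]].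
pose E2 := [set p : T * T | [&& p.1 \in Y, p.2 \in U & e p.1 p.2]].
have cE2 : #|E2| = \sum_l #|links e A S Y labU l|.
  rewrite -sum1_card (partition_big (fun p => labU p.2) predT) //=.
  apply: eq_bigr => l _; rewrite -sum1_card; apply: eq_bigl => p.
  by rewrite !inE -/S -/Y -!andbA.
have cW : 2 * #|S| + (#|E1| + #|E2|) <= #|W|.
  have E12 : E1 :&: E2 = set0.
    apply/setP => -[y v]; rewrite !inE /= -/S -/Y; apply/negP.
    by case/andP => /and3P[_ -> _] /and3P[].
  rewrite -cardsUI E12 cards0 addn0.
  have -> : 2 * #|S| = #|setX S [set: bool]| by rewrite cardsX cardsT card_bool mulnC.
  rewrite -(card_imset _ (@inl_inj (T * bool) (T * T))).
  rewrite -(card_imset _ (@inr_inj (T * bool) (T * T))).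
  rewrite -cardsUI [X in _ + X](_ : _ = 0) ?addn0; last first.
    apply/eqP; rewrite cards_eq0; apply/eqP/setP => z; rewrite inE in_set0.
    by apply/negP => /andP[/imsetP[? _ ->] /imsetP[]].
  apply/subset_leq_card/subsetP => z; rewrite inE => /orP[] /imsetP[p].
    case: p => v i; rewrite inE /= => /andP[Sv _] ->.
    by rewrite copy_in // (subsetP sSA).
  case: p => y v; rewrite inE => /orP[]; rewrite inE /= => /and3P[Yy _ eyv] ->;
  by rewrite dart_inE.
(* [Z] holds what may spoil the parity: copies of vertices of [Y], and halves from [S] towards [Y].
   Each of its elements accounts for at most one class. *)
pose Z : {set gadget} := [set inl p | p in setX Y [set: bool]] :|: [set inr (p.2, p.1) | p in E1].
have cZ : #|Z| <= 2 * #|Y| + #|E1|.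
  rewrite (leq_trans (leq_card_setU _ _)) // leq_add ?leq_imset_card //.
  rewrite (leq_trans (leq_imset_card _ _)) // cardsX cardsT card_bool mulnC //.
have sub : odd_labels B lab \subset
    [set lab z | z in Z] :|: [set l | odd #|links e A S Y labU l|].
  apply/subsetP => l; rewrite inE => Ol; rewrite inE.
  case: imsetP => //= noZ; rewrite inE -links_parity // => z Bz lz.
  case: z Bz lz => [[v i]|[u v]] Bz lz /=; apply/negP.
    move=> Yv; case: noZ; exists (inl (v, i)); rewrite // inE.
    by apply/orP; left; apply: imset_f; rewrite in_setX Yv in_setT.
  move=> /andP[Su Yv]; case: noZ; exists (inr (u, v)); rewrite // inE; apply/orP; right.
  apply/imsetP; exists (v, u) => //; rewrite in_set /= Su Yv e_sym.
  by have := Bz; rewrite in_setD in_set => /andP[].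
have cO : #|odd_labels B lab| <= 2 * #|Y| + #|E1| + \sum_l odd #|links e A S Y labU l|.
  rewrite (leq_trans (subset_leq_card sub)) // (leq_trans (leq_card_setU _ _)) //.
  rewrite leq_add ?(leq_trans (leq_imset_card _ _)) //.
  by rewrite -sum1dep_card big_mkcond /=; apply: leq_sum => l _; case: odd.
have sumE : \sum_l #|links e A S Y labU l| =
    \sum_l odd #|links e A S Y labU l| + 2 * \sum_l #|links e A S Y labU l|./2.
  rewrite big_distrr -big_split /=; apply: eq_bigr => l _.
  by rewrite mul2n odd_double_half.
rewrite cE2 in cW; have arith (w o y c h s E q : nat) : w < o -> o <= 2 * y + c + h ->
  2 * s + (c + E) <= w -> E = h + 2 * q -> s + q < y by lia.
exact: arith ltW cO cW sumE.
Qed.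

End GadgetBarrier.

Theorem two_factor_or_barrier :
  (exists F : rel T, [/\ subrel F e, symmetric F &
    {in A, forall x, #|[set y | F x y]| = 2}]) \/
  (exists S Y (lab : {ffun T -> gadget}), barrier e A S Y lab).
Proof.
have [d0|d_gt0] := posnP (defect gadget_rel gadget_set).
  left; have [f /andP[mf /eqP df]] := ex_optimal gadget_rel gadget_set.
  by apply: (perfect_gadget_two_factor mf); apply: cards0_eq; rewrite df d0.
right; have [W0 [lab0 [sW0 lab0_e le0]]] := gallai_barrier gadget_sym gadget_irr gadget_set.
(* Labellings become finite functions, so that a smallest [W] can be chosen. *)
pose P (p : {set gadget} * {ffun gadget -> gadget}) :=
  [&& p.1 \subset gadget_set,
      [forall x in gadget_set :\: p.1, forall y in gadget_set :\: p.1,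
         gadget_rel x y ==> (p.2 x == p.2 y)] &
      #|p.1| < #|odd_labels (gadget_set :\: p.1) p.2|].
have fin (lab : gadget -> gadget) B : odd_labels B (finfun lab) = odd_labels B lab.
  apply/setP => l; rewrite !inE; congr (odd #|pred_of_set _|); apply/setP => x.
  by rewrite !inE ffunE.
have P0 : P (W0, finfun lab0).
  have lt0 : #|W0| < #|odd_labels (gadget_set :\: W0) lab0|.
    by apply: leq_trans le0; rewrite -add1n leq_add2r.
  rewrite /P /= sW0 fin lt0 andbT.
  apply/forall_inP => x Bx; apply/forall_inP => y By; apply/implyP => exy.
  by rewrite !ffunE (lab0_e x y).
case: (@arg_minnP _ _ P (fun p => #|p.1|) P0) => -[W lab] /and3P[/= sW lab_e ltW] minW.
have lab_e' : {in gadget_set :\: W &, forall x y, gadget_rel x y -> lab x = lab y}.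
  by move=> x y Bx By exy; have /forall_inP/(_ x Bx)/forall_inP/(_ y By) := lab_e;
     rewrite exy => /eqP.
eexists; eexists; eexists; apply: (gadget_barrier sW lab_e' ltW) => d lab' Wd lab'_e.
rewrite leqNgt; apply/negP => lt'; have := minW (W :\ d, finfun lab').
rewrite /P /= fin lt' (subset_trans (subD1set _ _) sW) andbT /=.
rewrite (cardsD1 d W) Wd add1n ltnn => H; suff : false by []; apply: H.
apply/forall_inP => x Bx; apply/forall_inP => y By; apply/implyP => exy.
by rewrite !ffunE (lab'_e x y).
Qed.

End TwoFactor.

(** * Extremal barriers *)

Section TightBarrier.
Variables (T L : finType) (e : rel T) (A : {set T}).
Hypothesis e_sym : symmetric e.
Implicit Types (S Y : {set T}) (lab : {ffun T -> L}).

Lemma barrierP S Y lab :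
  reflect [/\ S \subset A, Y \subset A /\ [disjoint S & Y],
      {in Y &, forall x y, ~~ e x y},
      {in rest A S Y &, forall x y, e x y -> lab x = lab y} &
      #|S| + \sum_l #|links e A S Y lab l|./2 < #|Y|]
    (barrier e A S Y lab).
Proof.
apply: (iffP and5P) => [[sS sY dSY indY /andP[lab_e lt]]|[sS [sY dSY] indY lab_e lt]].
  split=> // x y Bx By; first by move/forall_inP/(_ x Bx)/forall_inP/(_ y By): indY.
  by move/forall_inP/(_ x Bx)/forall_inP/(_ y By)/implyP: lab_e => H /H/eqP.
split=> //; first by apply/forall_inP => x Bx; apply/forall_inP => y; exact: indY.
rewrite lt andbT; apply/forall_inP => x Bx; apply/forall_inP => y By.
by apply/implyP => exy; rewrite (lab_e x y).
Qed.

Lemma linksP S Y lab l p :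
  reflect [/\ p.1 \in Y, p.2 \in rest A S Y, e p.1 p.2 & lab p.2 = l]
    (p \in links e A S Y lab l).
Proof. by rewrite [X in reflect _ X]in_set; apply: (iffP and4P) => -[? ? ? /eqP ?]; split. Qed.

Lemma restP S Y v : reflect [/\ v \in A, v \notin S & v \notin Y] (v \in rest A S Y).
Proof.
by rewrite in_setD in_setU negb_or -andbA; apply: (iffP and3P) => -[? ? ?]; split.
Qed.

Section Moves.
Variables (S Y : {set T}) (lab : {ffun T -> L}).
Hypothesis SY : barrier e A S Y lab.
Let U := rest A S Y.
Let cnt l := #|links e A S Y lab l|.

(* Moving [y] from [Y] to the rest merges the classes adjacent to [y]. *)
Lemma barrier_drop y (N := [set u in U | e y u]) : y \in Y ->
  #|[set l in lab @: N | odd (cnt l)]| < #|N| ->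
  exists lab', barrier e A S (Y :\ y) lab'.
Proof.
move=> Yy ltN; have /barrierP[sS [sY dSY] indY lab_e lt] := SY.
have nSy : y \notin S by rewrite (disjointFl dSY).
have /card_gt0P[u0 Nu0] : 0 < #|N| by exact: leq_ltn_trans ltN.
have NP u : reflect (u \in U /\ e y u) (u \in N) by rewrite [X in reflect _ X]in_set; exact: andP.
pose Al := lab @: N; pose l0 := lab u0.
have Al0 : l0 \in Al by exact: imset_f.
pose lab' := [ffun v => if (v == y) || (lab v \in Al) then l0 else lab v].
have inU' v : (v \in rest A S (Y :\ y)) = (v == y) || (v \in U).
  apply/restP/idP => [[Av nS]|/predU1P[->|/restP[Av nS nY]]].
  - rewrite in_setD1 negb_and negbK; case: eqP => //= _ nY.
    by apply/restP.
  - by split; rewrite ?setD11 // (subsetP sY).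
  - by split; rewrite // in_setD1 (negbTE nY) andbF.
exists lab'; apply/barrierP; split=> //.
- by split; [rewrite (subset_trans (subD1set _ _))|rewrite (disjointWr (subD1set _ _))].
- by move=> x z /setD1P[_ Yx] /setD1P[_ Yz]; exact: indY.
- move=> v w; rewrite !inU' !ffunE; have [->|nvy] := eqVneq v y; have [->|nwy] := eqVneq w y => //=.
  + by move=> _ Uw eyw; rewrite imset_f //; apply/NP.
  + by move=> Uv _; rewrite e_sym => eyv; rewrite imset_f //; apply/NP.
  + by move=> Uv Uw evw; rewrite (lab_e v w).
pose cnt' l := #|links e A S (Y :\ y) lab' l|.
have cnt'_out l : l \notin Al -> cnt' l = cnt l.
  move=> nAl; congr #|pred_of_set _|; apply/setP => p; apply/linksP/linksP.
    case=> /setD1P[ny Yp]; rewrite inU' ffunE; case: eqP => [p2 _ ep _|_ /= Up ep].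
      by rewrite p2 in ep; have := indY _ _ Yp Yy; rewrite ep.
    by case: ifP => [_ l0E|_ //]; rewrite -l0E Al0 in nAl.
  case=> Yp Up ep lp; have n2 : p.2 != y.
    by apply: contraTneq Up => ->; apply/restP => -[_ _]; rewrite Yy.
  have n1 : p.1 != y.
    by apply: contraNneq nAl => p1; rewrite -lp imset_f //; apply/NP; rewrite -p1.
  split=> //; first by rewrite in_setD1 n1.
    by rewrite inU' Up orbT.
  by rewrite ffunE (negbTE n2) lp /= (negbTE nAl).
have cnt'_in l : l \in Al -> l != l0 -> cnt' l = 0.
  move=> lAl nl0; apply/eqP; rewrite cards_eq0; apply/eqP/setP => p; rewrite in_set0.
  apply/linksP => -[_ _ _]; rewrite ffunE; case: ifP => [_ l0E|/norP[_ nAl] lE].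
    by rewrite l0E eqxx in nl0.
  by rewrite lE lAl in nAl.
(* The merged class keeps the links of its parts except the [|N|] links at [y]; as [Y] is
   independent, no link ends in [y]. *)
have cnt'_0 : cnt' l0 + #|N| <= \sum_(l in Al) cnt l.
  pose big := [set p : T * T | [&& p.1 \in Y, p.2 \in U, e p.1 p.2 & lab p.2 \in Al]].
  have <- : #|big| = \sum_(l in Al) cnt l.
    rewrite -sum1_card (partition_big (fun p => lab p.2) (mem Al)) /=.
      apply: eq_bigr => l lAl; rewrite /cnt -sum1_card; apply: eq_bigl => p.
      apply/andP/linksP => [[]|[Yp Up ep lE]].
        by rewrite in_set => /and4P[? ? ? _] /eqP.
      by rewrite in_set Yp Up ep lE lAl eqxx.
    by move=> p; rewrite in_set => /and4P[].
  have -> : #|N| = #|[set (y, u) | u in N]| by rewrite card_imset // => u v [].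
  rewrite -cardsUI [X in _ + X](_ : _ = 0) ?addn0; last first.
    apply/eqP; rewrite cards_eq0; apply/eqP/setP => p; rewrite in_setI in_set0.
    apply/negP => /andP[/linksP[/setD1P[/eqP p1 _] _ _ _] /imsetP[u _ pE]].
    by rewrite pE in p1.
  apply/subset_leq_card/subsetP => p; rewrite in_setU => /orP[/linksP[]|].
    move=> /setD1P[_ Yp]; rewrite inU' ffunE; case: eqP => [p2 _ ep _|_ /= Up ep].
      by rewrite p2 in ep; have := indY _ _ Yp Yy; rewrite ep.
    rewrite in_set Yp Up ep; case: ifP => //= nAl lE; by rewrite lE Al0 in nAl.
  case/imsetP => u /NP[Uu eyu] ->; rewrite in_set /= Yy Uu eyu imset_f //.
  by apply/NP.
have sumE f : \sum_l f l = \sum_(l in Al) f l + \sum_(l | l \notin Al) f l :> nat.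
  by rewrite (bigID (mem Al)).
have sum' : \sum_l (cnt' l)./2 = (cnt' l0)./2 + \sum_(l | l \notin Al) (cnt l)./2.
  rewrite sumE (bigD1 l0) //= big1 ?addn0 => [|l /andP[lAl nl0]]; last first.
    by rewrite cnt'_in.
  by congr (_ + _); apply: eq_bigr => l nAl; rewrite cnt'_out.
have sum_in : \sum_(l in Al) cnt l =
    #|[set l in lab @: N | odd (cnt l)]| + 2 * \sum_(l in Al) (cnt l)./2.
  rewrite -sum1dep_card big_mkcondr /= big_distrr -big_split /=.
  apply: eq_bigr => l _; rewrite mul2n -{1}(odd_double_half (cnt l)).
  by case: odd.
(* With fewer odd classes than neighbors the merged count is below [2 * m], so its half is below [m]
   and pays for the loss of [y] in [Y]. *)
have := lt; rewrite (cardsD1 y Y) Yy -/cnt -/cnt' sum' sumE.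
rewrite sum_in in cnt'_0.
have arith (s c n o m r t : nat) : o < n -> c + n <= o + 2 * m ->
  s + (m + r) < 1 + t -> s + (c./2 + r) < t by clear; lia.
exact: arith ltN cnt'_0.
Qed.

(* Moving [u] from the rest to [S] removes at least two links. *)
Lemma barrier_add u y1 y2 : u \in U -> y1 \in Y -> y2 \in Y -> y1 != y2 ->
  e y1 u -> e y2 u -> barrier e A (u |: S) Y lab.
Proof.
move=> Uu Yy1 Yy2 n12 e1 e2; have /barrierP[sS [sY dSY] indY lab_e lt] := SY.
have /restP[Au nSu nYu] := Uu.
have inU' v : (v \in rest A (u |: S) Y) = (v != u) && (v \in U).
  apply/restP/andP => [[Av]|[nvu /restP[Av nS nY]]].
    by rewrite in_setU1 negb_or => /andP[-> nS] nY; split=> //; apply/restP.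
  by split; rewrite // in_setU1 negb_or nvu.
apply/barrierP; split=> //.
- by rewrite subUset sub1set Au.
- by split=> //; rewrite -setI_eq0 setIUl setU_eq0 !setI_eq0 disjoints1 nYu.
- by move=> x z; rewrite !inU' => /andP[_ Ux] /andP[_ Uz]; exact: lab_e.
pose cnt' l := #|links e A (u |: S) Y lab l|.
have sub l : links e A (u |: S) Y lab l \subset links e A S Y lab l.
  apply/subsetP => p /linksP[Yp]; rewrite inU' => /andP[_ Up] ep lp.
  by apply/linksP.
have le_u : cnt' (lab u) + 2 <= cnt (lab u).
  have -> : 2 = #|[set (y1, u); (y2, u)]|.
    by rewrite cards2; case: eqVneq => // -[y12]; rewrite y12 eqxx in n12.
  rewrite -cardsUI [X in _ + X](_ : _ = 0) ?addn0; last first.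
    apply/eqP; rewrite cards_eq0; apply/eqP/setP => p; rewrite in_setI in_set0.
    apply/negP => /andP[/linksP[_]]; rewrite inU' => /andP[/eqP p2 _] _ _.
    by case/set2P => pE; rewrite pE in p2.
  apply/subset_leq_card; rewrite subUset sub; apply/subsetP => p.
  by case/set2P => ->; apply/linksP.
rewrite cardsU1 nSu -/cnt'; move: lt; rewrite -/cnt !(bigD1 (lab u) isT) /=.
have : \sum_(l | l != lab u) (cnt' l)./2 <= \sum_(l | l != lab u) (cnt l)./2.
  by apply: leq_sum => l _; apply: half_leq; apply: subset_leq_card.
have arith (s a b m n t : nat) : a + 2 <= b -> m <= n -> s + (b./2 + n) < t ->
  1 + s + (a./2 + m) < t by clear; lia.
exact: arith le_u.
Qed.

End Moves.

(** In an extremal barrier neither move applies. For [y] in [Y], the neighbors in the rest are then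
    at most as many as the odd classes they meet, which puts them into distinct classes, all odd. *)
Lemma tight_barrier S0 Y0 lab0 : barrier e A S0 Y0 lab0 ->
  exists S Y lab, [/\ barrier e A S Y lab,
    forall y u, y \in Y -> u \in rest A S Y -> e y u ->
      odd #|links e A S Y lab (lab u)|,
    forall y u v, y \in Y -> u \in rest A S Y -> v \in rest A S Y ->
      e y u -> e y v -> lab u = lab v -> u = v &
    forall y1 y2 u, y1 \in Y -> y2 \in Y -> u \in rest A S Y ->
      e y1 u -> e y2 u -> y1 = y2].
Proof.
move=> b0; pose P (p : {set T} * {set T} * {ffun T -> L}) := barrier e A p.1.1 p.1.2 p.2.
(* A lexicographic measure: the factor [#|T|.+1] exceeds every complement, so enlarging [S]
   outweighs any change of [Y]. *)
pose F (p : {set T} * {set T} * {ffun T -> L}) := #|p.1.1| * #|T|.+1 + #|~: p.1.2|.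
case: (@arg_maxnP _ (S0, Y0, lab0) P F b0) => -[[S Y] lab]; rewrite /P /F /= => b max.
exists S, Y, lab; have drop y : y \in Y ->
    #|[set u in rest A S Y | e y u]| <=
    #|[set l in lab @: [set u in rest A S Y | e y u] | odd #|links e A S Y lab l| ]|.
  move=> Yy; rewrite leqNgt; apply/negP => /(barrier_drop b Yy)[lab' b'].
  have := max (S, Y :\ y, lab') b'; rewrite /= leq_add2l leqNgt => /negP; apply.
  apply: proper_card; rewrite properC; exact: properD1.
split=> //.
- move=> y u Yy Uu eyu; have := drop _ Yy; set N := [set u in _ | _] => leN.
  have /eqP E : [set l in lab @: N | odd #|links e A S Y lab l| ] == lab @: N.
    rewrite eqEcard; apply/andP; split; first by apply/subsetP => l; rewrite inE => /andP[].
    exact: leq_trans (leq_imset_card _ _) leN.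
  have : lab u \in lab @: N by apply: imset_f; rewrite in_set Uu.
  by rewrite -E in_set => /andP[].
- move=> y u v Yy Uu Uv eyu eyv; have := drop _ Yy; set N := [set u in _ | _] => leN.
  have /imset_injP injN : #|lab @: N| == #|N|.
    rewrite eqn_leq leq_imset_card (leq_trans leN) //; apply: subset_leq_card.
    by apply/subsetP => l; rewrite inE => /andP[].
  by apply: injN; rewrite // in_set ?Uu ?Uv.
move=> y1 y2 u Yy1 Yy2 Uu e1 e2; apply/eqP/negPn/negP => n12.
have b' := barrier_add b Uu Yy1 Yy2 n12 e1 e2.
have := max (u |: S, Y, lab) b'; rewrite /= cardsU1; have /restP[_ -> _] := Uu.
have arith (m c s : nat) : c <= m -> (1 + s) * m.+1 + c <= s * m.+1 + c -> false.
  by clear; nia.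
by move=> /= le; suff : false by []; exact: arith (max_card (mem (~: Y))) le.
Qed.

End TightBarrier.

(** * Vizing's adjacency lemma *)

(** [K] is the Kempe chain of [x], each color acting as an involution. It is a path with [x] as an
    end for [a], so [b] fixes at most one vertex of it. The [walk] follows it, starting with [b],
    and turns back at the first vertex fixed by [b]. *)
Lemma alternating_closed (T : finType) (a b : T -> T) x :
  involutive a -> involutive b -> a x = x ->
  exists K : {set T}, [/\ x \in K, forall v, (a v \in K) = (v \in K),
    forall v, (b v \in K) = (v \in K) &
    {in K &, forall z w, b z = z -> b w = w -> z = w}].
Proof.
move=> aK bK ax.
pose walk := fix walk k := if k is k'.+1 then (if odd k' then a else b) (walk k') else x.
pose r : rel T := fun u v => (v == a u) || (v == b u).
pose K := [set v | connect r x v].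
have stepK u v : r u v -> u \in K -> v \in K.
  by rewrite !inE => ruv xu; apply: connect_trans xu (connect1 ruv).
have Ka v : (a v \in K) = (v \in K).
  by apply/idP/idP; apply: stepK; rewrite /r ?aK eqxx.
have Kb v : (b v \in K) = (v \in K).
  by apply/idP/idP; apply: stepK; rewrite /r ?bK eqxx ?orbT.
have walk_a k : a (walk k) = walk (if odd k then k.+1 else k.-1).
  case: ifP => [/= -> //|]; case: k => //= k /negbFE ok.
  by rewrite ok aK.
have walk_b k : b (walk k) = walk (if odd k then k.-1 else k.+1).
  by case: ifP => [|/= -> //]; case: k => //= k /negbTE ->; rewrite bK.
have walkK v : v \in K -> exists k, v = walk k.
  rewrite inE => /connectP[p]; elim/last_ind: p v => [|p w IHp] v.
    by move=> _ ->; exists 0.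
  rewrite rcons_path last_rcons => /andP[pp lw ->].
  have [k lk] := IHp _ pp erefl; move: lw; rewrite lk /r => /orP[]/eqP ->.
    by rewrite walk_a; eexists.
  by rewrite walk_b; eexists.
exists K; split=> //; first by rewrite inE connect0.
move=> z w Kz Kw bz bw; have [i zE] := walkK z Kz.
have ex : exists k, b (walk k) == walk k by exists i; rewrite -zE bz.
case: (ex_minnP ex) => m /eqP bm min_m.
have m_even : ~~ odd m.
  apply/negP => om; have := walk_b m; rewrite om bm => wm.
  have : m <= m.-1 by apply: min_m; rewrite -wm bm.
  by case: m om {bm min_m wm} => //= m; rewrite ltnn.
have bounded k : exists2 j, j <= m & walk k = walk j.
  elim: k => [|k [j lejm wk]]; first by exists 0.
  rewrite /= wk; move: lejm; rewrite leq_eqVlt => /predU1P[jm|ltjm].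
    case: (odd k); last by exists m => //; rewrite jm bm.
    rewrite walk_a jm (negbTE m_even); exists m.-1 => //; exact: leq_pred.
  have lt_pred : j.-1 <= m by rewrite (leq_trans (leq_pred _)) // ltnW.
  by case: (odd k); [rewrite walk_a|rewrite walk_b]; case: (odd j); eexists; try reflexivity.
have fixed v : v \in K -> b v = v -> v = walk m.
  move=> /walkK[k vE]; have [j lejm wk] := bounded k; rewrite vE wk => bj.
  suff -> : j = m by [].
  by apply/eqP; rewrite eqn_leq lejm min_m ?bj.
by rewrite (fixed z) // (fixed w).
Qed.

(** * Fans and Kempe changes at an uncolored edge *)

Section Fans.
Variables (T C : finType) (g : rel T).
Hypotheses (g_sym : symmetric g) (g_irr : irreflexive g).
Implicit Types (c : {set T} -> C) (h : rel T).

(** Colorings are total on vertex sets, so one [c] can be read on a graph and on the graph minus an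
    edge. *)
Definition proper_col h c := forall v u w, h v u -> h v w ->
  c [set v; u] = c [set v; w] -> u = w.

Definition missing h c v (al : C) := [forall u, h v u ==> (c [set v; u] != al)].

Lemma missingP h c v al :
  reflect (forall u, h v u -> c [set v; u] <> al) (missing h c v al).
Proof.
apply: (iffP forallP) => H u; first by move=> hvu; apply/eqP; have /implyP := H u; exact.
by apply/implyP => hvu; apply/eqP; exact: H.
Qed.

Definition minus_edge h (x z : T) : rel T := fun u v => h u v && ([set u; v] != [set x; z]).

Lemma minus_edge_sym h x z : symmetric h -> symmetric (minus_edge h x z).
Proof. by move=> hs u v; rewrite /minus_edge hs setUC. Qed.

Lemma set2_eq (x y z : T) : ([set x; y] == [set x; z]) = (y == z).
Proof.
apply/eqP/eqP => [E|-> //].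
have := set22 x y; rewrite E => /set2P[yx|//].
by have := set22 x z; rewrite -E => /set2P[->|->]; rewrite ?yx.
Qed.

Definition recolor c (x z : T) al (s : {set T}) := if s == [set x; z] then al else c s.

Lemma proper_recolor h c x z al : symmetric h ->
  proper_col (minus_edge h x z) c ->
  missing (minus_edge h x z) c x al -> missing (minus_edge h x z) c z al ->
  proper_col h (recolor c x z al).
Proof.
move=> hs pc /missingP mx /missingP mz.
have col v u w : h v u -> h v w -> [set v; u] = [set x; z] -> al = c [set v; w] ->
    [set v; w] != [set x; z] -> u = w.
  move=> hu hw uE cE nw; have : v \in [set x; z] by rewrite -uE set21.
  case/set2P => vE; rewrite vE in hw cE nw.
    by case: (mx w); rewrite // /minus_edge hw.
  by case: (mz w); rewrite // /minus_edge hw.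
move=> v u w hu hw; rewrite /recolor; case: eqP => [uE|/eqP nu]; case: eqP => [wE|/eqP nw].
- by move=> _; apply/eqP; rewrite -(set2_eq v) uE wE.
- by move=> cE; apply: col hu hw uE cE nw.
- by move=> cE; apply/esym; apply: col hw hu wE _ nu.
- by apply: pc; rewrite /minus_edge ?hu ?hw.
Qed.

Variables (x y : T).
Hypothesis (gxy : g x y).
Hypothesis uncolorable : forall c, ~ proper_col g c.

Let g' := minus_edge g x y.

Let g'_sym : symmetric g'. Proof. exact: minus_edge_sym. Qed.

Let g'x z : g' x z = g x z && (z != y).
Proof. by rewrite /g' /minus_edge set2_eq. Qed.

(* The end reached last comes first. *)
Fixpoint fan c (s : seq T) : bool :=
  match s with
  | [::] => false
  | z :: s' => match s' with
      | [::] => z == y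
      | w :: _ => [&& g' x z, z \notin s', missing g' c w (c [set x; z]) & fan c s']
      end
  end.

Lemma fan_cons c z w s : fan c [:: z, w & s] =
  [&& g' x z, z \notin w :: s, missing g' c w (c [set x; z]) & fan c (w :: s)].
Proof. by []. Qed.

Lemma fan_neq c s : fan c s -> x \notin s.
Proof.
elim: s => // z [|w s] IHs /=.
  by move/eqP->; rewrite inE; apply: contraTneq gxy => ->; rewrite g_irr.
case/and4P => gxz _ _ /IHs; rewrite !inE !negb_or => ->; rewrite andbT.
by apply: contraTneq gxz => <-; rewrite g'x g_irr.
Qed.

Lemma eq_fan c c' s :
  (forall z, z \in s -> g' x z -> c' [set x; z] = c [set x; z]) ->
  (forall z w, z \in s -> w \in s -> g' x z -> missing g' c w (c [set x; z]) ->
     missing g' c' w (c [set x; z])) ->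
  fan c s -> fan c' s.
Proof.
elim: s => // z [//|w s] IHs eqc eqm /= /and4P[gxz nz mw fs].
rewrite gxz nz eqc ?mem_head // eqm ?inE ?eqxx ?orbT //=.
apply: IHs fs => [u us|u v us vs]; first by apply: eqc; rewrite inE us orbT.
by apply: eqm; rewrite inE ?us ?vs orbT.
Qed.

(** Colors shift along the fan: the edge [x z] takes [al], which frees its old color at [x], and
    that color is missing at the preceding fan vertex. In the end the uncolored edge [x y] receives
    a color, against [uncolorable]. *)
Lemma fan_missing_disjoint c s z al : proper_col g' c -> fan c (z :: s) ->
  missing g' c x al -> missing g' c z al -> False.
Proof.
elim: s c z al => [|w s IHs] c z al pc.
  move=> /eqP -> mx my; exact: (uncolorable (proper_recolor g_sym pc mx my)).
move=> fzs mx mz; have nx := fan_neq fzs; move: fzs => /= /and4P[gxz nz mw fs].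
have sub v u : minus_edge g' x z v u -> g' v u by case/andP.
have missing_sub v : missing g' c v al -> missing (minus_edge g' x z) c v al.
  by move=> /missingP m; apply/missingP => u /sub; exact: m.
have pc' : proper_col g' (recolor c x z al).
  apply: proper_recolor; rewrite ?missing_sub // => v u1 u2 /sub h1 /sub h2; exact: pc.
have off v u : v != x -> v != z -> recolor c x z al [set v; u] = c [set v; u].
  move=> nvx nvz; rewrite /recolor; case: eqP => // E.
  by have := set21 v u; rewrite E !inE (negbTE nvx) (negbTE nvz).
have off_x u : u != z -> recolor c x z al [set x; u] = c [set x; u].
  by move=> nuz; rewrite /recolor set2_eq (negbTE nuz).
have off_missing v be : v != x -> v != z ->
    missing g' (recolor c x z al) v be = missing g' c v be.
  by move=> nvx nvz; apply: eq_forallb => u; rewrite off.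
have nzs v : v \in w :: s -> v != z by move=> vs; apply: contraNneq nz => <-.
have nxs v : v \in w :: s -> v != x.
  by move=> vs; apply: contraNneq nx => <-; rewrite inE vs orbT.
apply: (IHs (recolor c x z al) w (c [set x; z]) pc').
- apply: (@eq_fan c _ (w :: s)) fs => [v vs _|u v us vs _]; first by rewrite off_x ?nzs.
  by rewrite off_missing ?nxs ?nzs.
- apply/missingP => u gxu; have [->|nuz] := eqVneq u z.
    by rewrite /recolor eqxx => E; have /missingP/(_ z gxz) := mx; rewrite -E.
  rewrite off_x // => cE; case/eqP: nuz; exact: pc gxu gxz cE.
- by rewrite off_missing ?nxs ?nzs ?mem_head.
Qed.

Section Kempe.
Variables (c : {set T} -> C) (al be : C) (K : {set T}).
Hypotheses (pc : proper_col g' c) (mx : missing g' c x al) (Kx : x \in K).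
Hypothesis closedK : forall u v, g' u v -> (c [set u; v] == al) || (c [set u; v] == be) ->
  (u \in K) = (v \in K).

(** The exchange takes place off the chain of [x], so that nothing changes at [x]. *)
Let swap (s : {set T}) := if [disjoint s & K] then tperm al be (c s) else c s.

Let swapE u v : swap [set u; v] =
  if (u \notin K) && (v \notin K) then tperm al be (c [set u; v]) else c [set u; v].
Proof. by rewrite /swap -setI_eq0 setIUl setU_eq0 !setI_eq0 !disjoints1. Qed.

Let swap_in u v : u \in K -> swap [set u; v] = c [set u; v].
Proof. by move=> Ku; rewrite swapE Ku. Qed.

Let swap_out u v : u \notin K -> g' u v -> swap [set u; v] = tperm al be (c [set u; v]).
Proof.
move=> nKu guv; rewrite swapE nKu; case: (boolP (v \in K)) => //= Kv.
have := closedK guv; rewrite Kv (negbTE nKu).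
by case: tpermP => [->|->|//]; rewrite eqxx ?orbT => /(_ isT).
Qed.

Let swap_missing u ga : missing g' swap u ga =
  missing g' c u (if u \in K then ga else tperm al be ga).
Proof.
apply: eq_forallb => v; case guv: (g' u v) => //=; case: ifPn => Ku.
  by rewrite swap_in.
by rewrite swap_out // -(inj_eq (@perm_inj _ (tperm al be))) tpermK.
Qed.

Let swap_proper : proper_col g' swap.
Proof.
move=> v u w guv gwv; have [Kv|nKv] := boolP (v \in K).
  by rewrite !swap_in //; exact: pc.
by rewrite !swap_out // => /perm_inj; exact: pc.
Qed.

(* By induction swapping [al] and [be] outside [K] preserves the fan; if [z]
   were outside [K], then [x] and [z] would both miss [al] afterwards. *)
Lemma fan_kempe s z : fan c (z :: s) ->
  (missing g' c z be -> z \in K) /\ fan swap (z :: s).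
Proof.
elim: s z => [|w s IHs] z fz.
  split=> // mz; apply: contraT => nKz.
  have fz' : fan swap [:: z] by [].
  case: (fan_missing_disjoint swap_proper fz' (al := al)); rewrite swap_missing ?Kx //.
  by rewrite (negbTE nKz) tpermL.
have fz' : fan swap [:: z, w & s].
  move: fz; rewrite fan_cons => /and4P[gxz nz mw fs]; have [Kw fs'] := IHs w fs.
  rewrite fan_cons gxz nz fs' andbT /= swap_in // swap_missing.
  case: ifPn => // nKw; case: tpermP => // [E|E].
    by have /missingP/(_ z gxz) := mx; rewrite E.
  by rewrite E in mw; rewrite Kw in nKw.
split=> // mz; apply: contraT => nKz.
case: (fan_missing_disjoint swap_proper fz' (al := al)); rewrite swap_missing ?Kx //.
by rewrite (negbTE nKz) tpermL.
Qed.

End Kempe.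

(** The default [v] turns following the edge of color [al] into an involution that fixes the
    vertices missing [al]. *)
Let nbr c al v := odflt v [pick u | g' v u && (c [set v; u] == al)].

Let nbrP c al v u : proper_col g' c -> g' v u -> c [set v; u] = al -> nbr c al v = u.
Proof.
move=> pc gvu cE; rewrite /nbr; case: pickP => [w /andP[gvw /eqP cw]|/(_ u)] /=.
  by apply: pc gvw gvu _; rewrite cw.
by rewrite gvu cE eqxx.
Qed.

Let nbrK c al : proper_col g' c -> involutive (nbr c al).
Proof.
move=> pc v; rewrite {2}/nbr; case: pickP => [u /andP[gvu /eqP cE]|no] /=.
  by apply: nbrP => //; rewrite 1?g'_sym // setUC.
by rewrite /nbr; case: pickP => // u; rewrite no.
Qed.

Let nbr_missing c al v : missing g' c v al -> nbr c al v = v.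
Proof.
move=> /missingP m; rewrite /nbr; case: pickP => // u /andP[gvu /eqP cE].
by case: (m u gvu).
Qed.

(** By [fan_kempe] both vertices lie on the chain of [x] in the colors [al] and [be], which has only
    one vertex missing [be]. *)
Lemma fan_missing_inj c al be s z t w : proper_col g' c -> missing g' c x al ->
  fan c (z :: s) -> fan c (w :: t) -> missing g' c z be -> missing g' c w be -> z = w.
Proof.
move=> pc mx fz fw mz mw.
have [K [Kx Ka Kb inj]] :=
  alternating_closed (nbrK al pc) (nbrK be pc) (nbr_missing mx).
have closedK u v : g' u v -> (c [set u; v] == al) || (c [set u; v] == be) ->
    (u \in K) = (v \in K).
  move=> guv /orP[]/eqP cE; first by rewrite -Ka (nbrP pc guv cE).
  by rewrite -Kb (nbrP pc guv cE).
have [Kz _] := fan_kempe pc mx Kx closedK fz.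
have [Kw _] := fan_kempe pc mx Kx closedK fw.
by apply: inj; rewrite ?Kz ?Kw ?nbr_missing.
Qed.

(** The union of all fans, as a reachability set; shortening a path supplies the distinctness that a
    fan requires. *)
Definition fan_set c := [set z | connect
  (fun w z => g' x z && missing g' c w (c [set x; z])) y z].

Lemma fan_setP c z : z \in fan_set c -> exists s, fan c (z :: s).
Proof.
rewrite inE => /connectP[p0 pp0 ->]; case/shortenP: pp0 => p pp up _.
suff : exists2 s, fan c (last y p :: s) & {subset last y p :: s <= y :: p}.
  by case=> s; exists s.
elim/last_ind: p pp up => [|p z' IHp]; first by exists [::]; rewrite /= ?eqxx.
rewrite rcons_path -rcons_cons rcons_uniq last_rcons.
case/andP => pp /andP[gz mz] /andP[nz up]; have [s fs sub] := IHp pp up.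
exists (last y p :: s) => [|v].
  by rewrite fan_cons gz mz fs /= andbT; apply: contra nz => /sub.
rewrite in_cons mem_rcons => /predU1P[->|/sub vp]; first exact: mem_head.
by rewrite in_cons vp orbT.
Qed.

Lemma fan_set0 c : y \in fan_set c.
Proof. by rewrite inE connect0. Qed.

Lemma fan_set_step c w z : w \in fan_set c -> g' x z ->
  missing g' c w (c [set x; z]) -> z \in fan_set c.
Proof.
rewrite !inE => yw gxz mw; apply: connect_trans yw (connect1 _).
by rewrite gxz.
Qed.

Let deg h v := #|[set u | h v u]|.

Lemma card_missing h c v : proper_col h c ->
  #|[set ga | missing h c v ga]| + deg h v = #|C|.
Proof.
move=> pc; have -> : deg h v = #|[set c [set v; u] | u in [set u | h v u]]|.
  by rewrite card_in_imset // => u w; rewrite !inE => hu hw; exact: pc.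
rewrite -cardsT -(cardsID [set ga | missing h c v ga] setT) setTI; congr (_ + _).
congr #|pred_of_set _|; apply/setP => ga; rewrite !inE andbT; apply/imsetP/forallPn.
  by case=> u; rewrite inE => hu ->; exists u; rewrite hu eqxx.
by case=> u; rewrite negb_imply negbK => /andP[hu /eqP <-]; exists u; rewrite ?inE.
Qed.

Lemma deg_minus v : deg g v = (v \in [set x; y]) + deg g' v.
Proof.
rewrite /deg in_set2; case: (eqVneq v y) => [->|nvy]; rewrite ?orbT ?orbF.
  rewrite (cardsD1 x) inE g_sym gxy; congr (_ + _); congr #|pred_of_set _|.
  apply/setP => u; rewrite !inE /g' /minus_edge [ [set x; y] ]setUC set2_eq andbC.
  by rewrite andbC.
case: (eqVneq v x) => [->|nvx].
  rewrite (cardsD1 y) inE gxy; congr (_ + _); congr #|pred_of_set _|.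
  by apply/setP => u; rewrite !inE g'x andbC.
congr #|pred_of_set _|; apply/setP => u; rewrite !inE /g' /minus_edge.
case: eqP => [E|]; rewrite ?andbT //.
by have := set21 v u; rewrite E !inE (negbTE nvx) (negbTE nvy).
Qed.

(** Once the edge is removed, [x] and [y] have no missing color in common. *)
Lemma edge_degree_sum c : proper_col g' c -> #|C|.+2 <= deg g x + deg g y.
Proof.
move=> pc; have := card_missing x pc; have := card_missing y pc.
rewrite !deg_minus set21 set22.
have : #|[set ga | missing g' c x ga]| + #|[set ga | missing g' c y ga]| <= #|C|.
  rewrite -cardsUI [X in _ + X](_ : _ = 0) ?addn0 ?max_card //.
  apply/eqP; rewrite cards_eq0; apply/eqP/setP => ga; rewrite !inE; apply/negP.
  by case/andP => mx my; apply: (@fan_missing_disjoint c [::] y ga) => //=.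
have arith (a b k dx dy : nat) : b + a <= k -> a + dy = k -> b + dx = k ->
  k.+2 <= 1 + dx + (1 + dy) by clear; lia.
exact: arith.
Qed.

(** The colors missing at fan vertices are pairwise distinct. Each occurs at [x], on an edge leading
    into [Z :\ y], so in total there are at most [|Z| - 1]. Since [y] misses [|C| + 1 - deg y] of
    them, at least that many other fan vertices miss none, that is, have degree [|C|]. *)
Lemma vizing_adjacency c : proper_col g' c -> (forall v, deg g v <= #|C|) ->
  #|C|.+1 <= deg g y + #|[set w | [&& g x w, w != y & deg g w == #|C|]]|.
Proof.
move=> pc deg_le.
have [al mx] : exists al, missing g' c x al.
  have := card_missing x pc; have := deg_le x; rewrite deg_minus set21.
  case: (posnP #|[set ga | missing g' c x ga]|) => [->|]; first by lia.
  by case/card_gt0P => al; rewrite inE => mal; exists al.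
pose Z := fan_set c; pose M w := [set ga | missing g' c w ga].
have cardM : \sum_(w in Z) #|M w| <= #|Z :\ y|.
  have -> : \sum_(w in Z) #|M w| = #|[set p : T * C | (p.1 \in Z) && (p.2 \in M p.1)]|.
    rewrite -sum1dep_card -(pair_big_dep (mem Z) (fun w ga => ga \in M w) (fun _ _ => 1)) /=.
    by apply: eq_bigr => w _; rewrite sum1_card.
  pose D := [set p : T * C | (p.1 \in Z) && (p.2 \in M p.1)].
  rewrite -/D -(@card_in_imset _ _ (@snd T C)).
    have injc : {in Z :\ y &, injective (fun z => c [set x; z])}.
      have gZ z : z \in Z :\ y -> g' x z.
        case/setD1P => nzy; rewrite inE => /connectP[p]; case/lastP: p => [|p w].
          by move=> _ zy; rewrite zy eqxx in nzy.
        by rewrite rcons_path last_rcons => /andP[_ /andP[gw _]] ->.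
      by move=> z w /gZ gz /gZ gw; exact: pc.
    rewrite -(card_in_imset injc); apply/subset_leq_card/subsetP => ga' /imsetP[[w ga] wga ->{ga'}].
    have {wga} [Zw mw] : w \in Z /\ missing g' c w ga.
      by move: wga; rewrite in_set /= => /andP[Zw]; rewrite in_set.
    have [s fs] := fan_setP Zw.
    have /forallPn[u] : ~~ missing g' c x ga.
      by apply/negP => mxga; exact: fan_missing_disjoint pc fs mxga mw.
    rewrite negb_imply negbK => /andP[gxu /eqP cE].
    apply/imsetP; exists u; last by rewrite cE.
    rewrite in_setD1 (fan_set_step Zw) ?cE // andbT.
    by move: gxu; rewrite g'x => /andP[].
  have DP p : p \in D -> p.1 \in Z /\ missing g' c p.1 p.2.
    by rewrite in_set => /andP[? H]; split=> //; move: H; rewrite in_set.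
  move=> [w ga] [w' ga'] /DP[/= Zw mw] /DP[/= Zw' mw'] /= gaE.
  rewrite -gaE in mw' *; congr pair; have [s fs] := fan_setP Zw.
  have [s' fs'] := fan_setP Zw'.
  exact: fan_missing_inj pc mx fs fs' mw mw'.
rewrite (big_setD1 y (fan_set0 c)) /= in cardM.
have My : #|M y| + deg g y = #|C|.+1.
  by rewrite -(card_missing y pc) deg_minus set22 add1n addnS.
have [good bad] : [set w in Z :\ y | deg g w == #|C|] \subset
       [set w | [&& g x w, w != y & deg g w == #|C|]] /\
    #|[set w in Z :\ y | deg g w != #|C|]| <= \sum_(w in Z :\ y) #|M w|.
  have Zx w : w \in Z :\ y -> g' x w /\ w != x.
    case/setD1P => nwy /fan_setP[[|v s]]; first by move=> /= wy; rewrite wy in nwy.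
    by move=> fs; have := fan_neq fs; move: fs => /= /and4P[gxw _ _ _];
       rewrite inE negb_or eq_sym => /andP[].
  split.
    apply/subsetP => w; rewrite in_set => /andP[/Zx[gxw _] dw].
    by rewrite inE dw andbT -g'x.
  rewrite -sum1_card big_mkcond [leqRHS]big_mkcond /=; apply: leq_sum => w _.
  rewrite in_set; case: ifP => // /andP[Zw dw]; rewrite Zw.
  have [gxw nwx] := Zx w Zw; have := card_missing w pc; have := deg_le w.
  move: gxw; rewrite g'x => /andP[_ nwy]; rewrite deg_minus in dw *.
  rewrite !inE (negbTE nwx) (negbTE nwy) /= add0n in dw *.
  by rewrite leq_eqVlt (negbTE dw) /= => lt E; move: lt;
  rewrite -E -{1}[deg g' w]add0n ltn_add2r.
have split_card := cardsID [set w | deg g w == #|C|] (Z :\ y).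
have {}good := subset_leq_card good; rewrite setIdE in good.
have badE : [set w in Z :\ y | deg g w != #|C|] = (Z :\ y) :\: [set w | deg g w == #|C|].
  by apply/setP => w; rewrite !inE andbC.
rewrite badE in bad.
have arith (a b z k d u v t : nat) : a + b <= z -> a + d = k.+1 -> u <= t -> v <= b ->
  u + v = z -> k < d + t by clear; lia.
exact: arith cardM My good bad split_card.
Qed.

End Fans.

(** * Critical and tough graphs *)

Section Graphs.
Variables (T : finType) (G : sgraph T).
Local Notation A := (vset G).
Local Notation k := (max_degree G).

Lemma edge_set2 s v : s \in edges G -> v \in s -> exists u, s = [set v; u].
Proof.
move=> Gs vs; have /forallP/(_ s)/implyP/(_ Gs)/andP[/cards2P[a [b [_ sE]]] _] := edges_wf G.
by move: vs; rewrite sE => /set2P[->|->]; [exists b|exists a; rewrite setUC].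
Qed.

Lemma degree_le v : degree G v <= k.
Proof.
have [Av|nAv] := boolP (v \in A); first exact: leq_bigmax_cond.
suff -> : degree G v = 0 by [].
apply/eqP; rewrite cards_eq0; apply/eqP/setP => u; rewrite !inE; apply/negP.
by move/adj_vset; rewrite (negbTE nAv).
Qed.

Lemma num_components_ge (L : finType) (lab : T -> L) :
  (forall x y, adj G x y -> lab x = lab y) -> #|lab @: A| <= num_components G.
Proof.
move=> lab_adj; rewrite /num_components /n_comp_mem.
have clA : closed (adj G) A by move=> x y /adj_vset/andP[-> ->].
have labc x y : connect (adj G) x y -> lab x = lab y.
  have cl : closed (adj G) [pred z | lab z == lab x].
    by move=> u v /lab_adj uv; rewrite !inE uv.
  by move/(closed_connect cl); rewrite !inE eqxx => /esym/eqP.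
apply: leq_trans (leq_imset_card lab _); apply: subset_leq_card.
apply/subsetP => l /imsetP[x Ax ->]; apply/imsetP.
exists (fingraph.root (adj G) x); last by apply: labc; exact: connect_root.
have sym := sym_connect_sym (adj_sym G).
by rewrite inE /= roots_root //= -(closed_connect clA (connect_root _ x)).
Qed.

Lemma adj_del (S : {set T}) x y :
  adj (del_vertices G S) x y -> [/\ adj G x y, x \notin S & y \notin S].
Proof.
rewrite /adj inE => /andP[Gxy /pred0P dis]; split=> //.
  by apply/negP => Sx; have := dis x; rewrite /= set21 Sx.
by apply/negP => Sy; have := dis y; rewrite /= set22 Sy.
Qed.

Lemma complete_components (S : {set T}) :
  complete G -> num_components (del_vertices G S) <= 1.
Proof.
move=> /forall_inP cG; rewrite /num_components /n_comp_mem.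
set H := del_vertices G S; have sym := sym_connect_sym (adj_sym H).
have root_eq x y : x \in vset H -> y \in vset H ->
    fingraph.root (adj H) x = fingraph.root (adj H) y.
  rewrite !in_setD => /andP[Sx Ax] /andP[Sy Ay]; apply/eqP; rewrite root_connect //.
  have [->//|nxy] := eqVneq x y; apply: connect1.
  have /forall_inP/(_ y Ay)/implyP/(_ nxy) Gxy := cG x Ax.
  rewrite /adj inE; apply/andP; split; first exact: Gxy.
  by rewrite -setI_eq0 setIUl setU_eq0 !setI_eq0 !disjoints1 Sx.
apply/card_le1_eqP => x y; rewrite !inE => /andP[/eqP rx Hx] /andP[/eqP ry Hy].
by rewrite -rx -ry; apply: root_eq; rewrite in_setD.
Qed.

End Graphs.

(** Applies toughness without determining components: a labelling constant along the edges of
    [G - S] bounds their number from below. Two labels also show that [G] is not complete, so its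
    toughness is a real number. *)
Lemma tough_labels (R : realType) (T L : finType) (G : sgraph T) (S : {set T}) (lab : T -> L) :
  ((3 / 2 : R)%:E <= toughness R G)%E -> S \subset vset G ->
  {in vset G :\: S &, forall x y, adj G x y -> lab x = lab y} ->
  2 <= #|lab @: (vset G :\: S)| -> 3 * #|lab @: (vset G :\: S)| <= 2 * #|S|.
Proof.
move=> toughG sS lab_adj le2; set H := del_vertices G S.
have le_c : #|lab @: (vset G :\: S)| <= num_components H.
  apply: (@num_components_ge _ H) => x y /adj_del[Gxy Sx Sy].
  by have /andP[Ax Ay] := adj_vset Gxy; apply: lab_adj; rewrite // in_setD ?Sx ?Sy.
have c2 := leq_trans le2 le_c.
have ncG : ~~ complete G.
  by apply/negP => /(complete_components S); rewrite leqNgt c2.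
have [t [tE t0 tG _]] := toughnessP R ncG.
rewrite tE lee_fin in toughG.
have le_t : (3 / 2 * (num_components H)%:R <= #|S|%:R :> R)%R.
  by apply: le_trans (tG S sS c2); rewrite ler_wpM2r.
have : (3 * (num_components H)%:R <= 2 * #|S|%:R :> R)%R by lra.
rewrite -!natrM ler_nat; apply: leq_trans.
by rewrite leq_mul2l.
Qed.

Section Critical.
Variables (T : finType) (G : sgraph T).
Hypothesis crit : Delta_critical G.
Local Notation A := (vset G).
Local Notation k := (max_degree G).

Lemma uncolorable_critical (c : {set T} -> 'I_k) : ~ proper_col (adj G) c.
Proof.
move=> pc; have [chiG _] := crit.
suff : edge_colorable G k.
  move=> kG; have := chiG; rewrite /chromatic_index; case: ex_minnP => m _ /(_ k kG).
  by move=> le mE; rewrite mE ltnn in le.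
apply/existsP; exists [ffun s => c (sval s)].
apply/forallP => s; apply/forallP => s'; apply/implyP => ns; apply/implyP.
case/set0Pn => v /setIP[vs vs']; rewrite !ffunE; apply: contra ns => /eqP cE.
have [u sE] := edge_set2 (valP s) vs; have [w sE'] := edge_set2 (valP s') vs'.
apply/eqP/val_inj; rewrite /= sE sE'; congr [set _; _]; apply: (pc v).
- by have := valP s; rewrite /= sE.
- by have := valP s'; rewrite /= sE'.
- by rewrite -sE -sE'.
Qed.

Lemma critical_coloring x y : adj G x y ->
  exists c : {set T} -> 'I_k, proper_col (minus_edge (adj G) x y) c.
Proof.
move=> Gxy; have wfH : [forall s in edges G :\ [set x; y], (#|s| == 2) && (s \subset A)].
  apply/forall_inP => s /setD1P[_ Gs].
  by have /forallP/(_ s)/implyP/(_ Gs) := edges_wf G.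
pose H := SGraph wfH; have [chiG /(_ H)] := crit.
have pH : proper_subgraph H G.
  rewrite /proper_subgraph /subgraph subxx subD1set /=; apply/orP; right.
  by apply: contraTneq Gxy => E; rewrite /adj -E setD11.
move/(_ pH); rewrite chiG ltnS {1}/chromatic_index.
case: ex_minnP => m /existsP[cf /forallP pcf] _ lemk.
have kpos : 0 < k.
  apply: leq_trans (degree_le G x); apply/card_gt0P; exists y.
  by rewrite inE.
(* Sets that are not edges of [H] get an arbitrary color, which is why [k] must be positive. *)
exists (fun s => if insub s is Some s' then widen_ord lemk (cf s') else Ordinal kpos).
have edgeH v u : minus_edge (adj G) x y v u -> [set v; u] \in edges H.
  by case/andP => Gvu nvu; rewrite in_setD1 nvu.
move=> v u w /edgeH hu /edgeH hw.
pose s : {s | s \in edges H} := exist (fun s => s \in edges H) _ hu.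
pose s' : {s | s \in edges H} := exist (fun s => s \in edges H) _ hw.
have -> : insub [set v; u] = Some s by exact: insubT.
have -> : insub [set v; w] = Some s' by exact: insubT.
move=> E; apply/eqP; rewrite -(set2_eq v); apply/negPn/negP => nuw.
have /forallP/(_ s')/implyP := pcf s; case/(_ _)/implyP/(_ _)/negP.
- by apply: contra nuw => /eqP/(congr1 val)/= ->.
- by apply/set0Pn; exists v; rewrite inE /= !set21.
by apply/eqP/val_inj; have := congr1 val E.
Qed.

Lemma critical_degree_sum x y : adj G x y -> k.+2 <= degree G x + degree G y.
Proof.
move=> Gxy; have [c pc] := critical_coloring Gxy.
have := edge_degree_sum (adj_sym G) (@adj_irrefl _ G) Gxy uncolorable_critical pc.
by rewrite card_ord.
Qed.

Lemma critical_adjacency x y : adj G x y ->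
  k.+1 <= degree G y + #|[set w | [&& adj G x w, w != y & degree G w == k]]|.
Proof.
move=> Gxy; have [c pc] := critical_coloring Gxy.
have := vizing_adjacency (adj_sym G) (@adj_irrefl _ G) Gxy uncolorable_critical pc.
by rewrite card_ord; apply; exact: degree_le.
Qed.

Lemma critical_edge : exists s, s \in edges G.
Proof.
have [chiG _] := crit; apply/set0Pn/negP => /eqP no_edge.
have : edge_colorable G 0.
  have no (s : {s : {set T} | s \in edges G}) : False.
    by case: s => s; rewrite no_edge inE.
  apply/existsP; exists [ffun s => match no s with end].
  by apply/forallP => s; case: (no s).
move=> col0; move: chiG; rewrite /chromatic_index; case: ex_minnP => m _ /(_ 0 col0).
by move=> le mE; rewrite mE in le.
Qed.

(** An isolated [y] would be separated from an edge with nothing deleted, which toughness forbids.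
    Otherwise an edge at [y] has degree sum at least [k + 2], and its other end takes at most
    [k]. *)
Lemma critical_min_degree (R : realType) y :
  ((3 / 2 : R)%:E <= toughness R G)%E -> y \in A -> 1 < degree G y.
Proof.
move=> toughG Ay; have [x Gxy|iso] := pickP (adj G y).
  have := critical_degree_sum Gxy; rewrite -addn2 => le; have := degree_le G x.
  by move: le; clear; lia.
have [s Gs] := critical_edge.
have /forallP/(_ s)/implyP/(_ Gs)/andP[/cards2P[a [b [_ sE]]] _] := edges_wf G.
have Gab : adj G a b by rewrite /adj -sE.
have nay : a != y by apply: contraTneq Gab => ->; rewrite iso.
have /andP[Aa _] := adj_vset Gab.
suff le2 : 2 <= #|(fun x => x == y) @: (A :\: set0)|.
  have := tough_labels toughG (sub0set _) _ le2; rewrite cards0 muln0 => H.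
  suff : 3 * #|(fun x => x == y) @: (A :\: set0)| <= 0 by move: le2; clear; lia.
  apply: H => u v _ _ Guv; have [uy|_] := eqVneq u y; first by rewrite uy iso in Guv.
  by apply/esym/negbTE; apply: contraTneq Guv => ->; rewrite adj_sym iso.
rewrite setD0; have -> : 2 = #|[set true; false]| by rewrite cards2.
apply: subset_leq_card; rewrite subUset !sub1set.
by rewrite -{1}(eqxx y) -(negbTE nay) !(imset_f (fun x => x == y)).
Qed.

End Critical.

(** * The counting argument *)

Section Counting.
Local Open Scope ring_scope.

(** Here [2 * K l + 1] is the number of links of an odd class, [u l] its size and [g l] a bound on
    the weight of each link. For [h <= q + 1] the weight 1/3 suffices. Otherwise the sum is compared
    with a linear form in [K], [u] and the indicator of [0 < K], chosen by whether three classes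
    have several links. *)
Lemma weight_bound (L : finType) (Lo : {set L}) (K u : L -> nat) (g : L -> rat)
    (s t q h Dl : nat) :
  q = (\sum_(l in Lo) K l)%N -> h = #|Lo| ->
  (forall l, l \in Lo -> 2 * K l < u l)%N ->
  (s + q < t)%N -> (3 * t <= 2 * (s + 2 * q))%N ->
  (2 <= h -> 3 * h <= 2 * (s + t))%N ->
  (s + t + \sum_(l in Lo) u l <= 3 * Dl)%N ->
  (forall l, l \in Lo -> [/\ 0 <= g l, 3 * g l <= 1 &
     3 * (Dl%:R - s%:R + 1) * g l <= (u l)%:R + 2]) ->
  \sum_(l in Lo) (2 * (K l)%:R + 1) * g l <= q%:R + 2 / 5.
Proof.
move=> qE hE uK le_t toughA toughB le_n gP.
set N := (\sum_(l in Lo) u l)%N in le_n; set M := Dl%:R - s%:R + 1 in gP.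
pose h1 := (\sum_(l in Lo) (0 < K l))%N.
have lin (a b c d : rat) : \sum_(l in Lo) (a * (K l)%:R + b * (u l)%:R + c + d * (0 < K l)%N%:R)
    = a * q%:R + b * N%:R + c * h%:R + d * h1%:R.
  rewrite !big_split /= -!mulr_sumr -!natr_sum -qE -/N -/h1 sumr_const -hE.
  by rewrite (mulr_natr c).
have le_N : (2 * q + h <= N)%N.
  rewrite qE hE big_distrr -sum1_card -big_split /=; apply: leq_sum => l /uK.
  by rewrite addn1.
(* The hypotheses give [q >= s + 3], hence [t >= 2 * s + 4]. *)
have le_M : (N + 3 * s + 4 <= 3 * Dl)%N by move: le_n le_t toughA; clear; lia.
have N_M : N%:R + 7 <= 3 * M.
  by have := le_M; rewrite -(ler_nat rat) !(natrM, natrD) /M; lra.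
have qh_N : 2 * q%:R + h%:R <= N%:R :> rat by rewrite -natrM -natrD ler_nat.
have q0 : 0 <= q%:R :> rat by [].
have h0 : 0 <= h%:R :> rat by [].
have Kcase l : K l = 0%N \/ 1 <= (K l)%:R :> rat.
  by case: (K l) => [|m]; [left|right; rewrite ler1n].
have [le_h|lt_h] := leqP h q.+1.
  apply: (@le_trans _ _ (2 / 3 * q%:R + 0 * N%:R + 1 / 3 * h%:R + 0 * h1%:R)).
    rewrite -lin; apply: ler_sum => l Ll; have [g0 g3 _] := gP l Ll.
    have : 0 <= (K l)%:R :> rat by [].
    by move=> K0; rewrite !mul0r !addr0; nra.
  by move: le_h; rewrite -(ler_nat rat) -addn1 natrD; lra.
have [h_q q6] : (9 * h <= 18 * q - 30)%N /\ (6 <= q)%N.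
  by move: toughA toughB le_t lt_h; clear; lia.
have M_pos : 0 < M by lra.
have h_q' : 9 * h%:R + 30 <= 18 * q%:R :> rat.
  by rewrite -!natrM -natrD ler_nat; move: h_q q6; clear; lia.
have q6' : 6 <= q%:R :> rat by rewrite ler_nat.
have lt_h' : q%:R + 2 <= h%:R :> rat by rewrite -natrD ler_nat addn2.
have u_ge l : l \in Lo -> 2 * (K l)%:R + 1 <= (u l)%:R :> rat.
  by move/uK; rewrite -(ler_nat rat) -addn1 !(natrM, natrD).
(* If three classes have several links, each saves [M - 2], and [N + 7 <= 3 * M] shows that this
   absorbs the term [N]. *)
have [le3|lt3] := leqP 3 h1.
  have h13 : 3 <= h1%:R :> rat by rewrite ler_nat.
  suff : M * \sum_(l in Lo) (2 * (K l)%:R + 1) * g l <= M * q%:R.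
    by rewrite ler_pM2l // => /le_trans; apply; lra.
  apply: (@le_trans _ _ (M * q%:R + 1 * N%:R + 0 * h%:R + (2 - M) * h1%:R)); last by nra.
  rewrite mulr_sumr -lin; apply: ler_sum => l Ll; have [g0 g3 gM] := gP l Ll.
  have := u_ge l Ll; have [->|K1] := Kcase l; first by rewrite ltnn /=; nra.
  have -> : (0 < K l)%N by rewrite -(ltr_nat rat); lra.
  move=> uK'; rewrite mul1r mulr1 addr0.
  have le1 : M * ((2 * (K l)%:R + 1) * g l) <= M * (K l)%:R * (3 * g l).
    have : 0 <= M * g l * ((K l)%:R - 1).
      by rewrite mulr_ge0 ?subr_ge0 // mulr_ge0 // ltW.
    by lra.
  apply: (le_trans le1); have [uM|uM] := lerP M ((u l)%:R + 2).
    have : M * (K l)%:R * (3 * g l) <= M * (K l)%:R * 1.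
      by rewrite ler_wpM2l // mulr_ge0 // ltW.
    by lra.
  have : (K l)%:R * (3 * M * g l) <= (K l)%:R * ((u l)%:R + 2) by rewrite ler_wpM2l.
  have : 0 <= (M - ((u l)%:R + 2)) * ((K l)%:R - 1).
    by rewrite mulr_ge0 // subr_ge0 // ltW.
  by lra.
have h12 : h1%:R <= 2 :> rat by rewrite (ler_nat _ _ 2).
have h10 : 0 <= h1%:R :> rat by [].
(* With at most two such classes, 1/3 is used on them and the size bound only on classes with one
   link. The term [- 2 * q] is due to [2 * K l + 1 <= u l]. *)
suff : 3 * M * \sum_(l in Lo) (2 * (K l)%:R + 1) * g l <= 3 * M * (q%:R + 2 / 5).
  by rewrite ler_pM2l //; lra.
apply: (@le_trans _ _ ((2 * M - 2) * q%:R + 1 * N%:R + 2 * h%:R + (M - 3) * h1%:R)); last first.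
  by nra.
rewrite mulr_sumr -lin; apply: ler_sum => l Ll; have [g0 g3 gM] := gP l Ll.
have := u_ge l Ll; have [->|K1] := Kcase l; first by rewrite ltnn /=; nra.
have -> : (0 < K l)%N by rewrite -(ltr_nat rat); lra.
have : 0 <= M * (2 * (K l)%:R + 1) * (1 - 3 * g l).
  by apply: mulr_ge0; [apply: mulr_ge0|]; lra.
by move=> uK'; rewrite mulr1; lra.
Qed.

End Counting.

(** * Counting edges at a tight barrier of a critical graph *)

Section TightCounting.
Variables (R : realType) (T L : finType) (G : sgraph T).
Variables (S Y : {set T}) (lab : {ffun T -> L}).
Local Notation A := (vset G).
Local Notation k := (max_degree G).
Let U := rest A S Y.
Let cnt l := #|links (adj G) A S Y lab l|.
Hypotheses (crit : Delta_critical G) (toughG : ((3 / 2 : R)%:E <= toughness R G)%E).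
Hypothesis order_le : #|A| <= 3 * k.
Hypothesis SY : barrier (adj G) A S Y lab.
Hypothesis odd_class : forall y u, y \in Y -> u \in U -> adj G y u -> odd (cnt (lab u)).
Hypothesis class_inj : forall y u v, y \in Y -> u \in U -> v \in U ->
  adj G y u -> adj G y v -> lab u = lab v -> u = v.
Hypothesis contact_inj : forall y1 y2 u, y1 \in Y -> y2 \in Y -> u \in U ->
  adj G y1 u -> adj G y2 u -> y1 = y2.

(** The contacts, which correspond to the edges between [Y] and [U] by [contact_inj]; [par] is the
    end in [Y]. *)
Let X := [set u in U | [exists y in Y, adj G y u]].
Let par u := odflt u [pick y in Y | adj G y u].
Let Lo := [set l | odd (cnt l)].
Let K l := (cnt l)./2.
Let cls l := [set u in U | lab u == l].
Let q := \sum_(l in Lo) K l.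

Let sSA : S \subset A. Proof. by have /barrierP[] := SY. Qed.
Let sYA : Y \subset A. Proof. by have /barrierP[_ []] := SY. Qed.
Let indY : {in Y &, forall x y, ~~ adj G x y}. Proof. by have /barrierP[] := SY. Qed.
Let dSY y : y \in Y -> y \notin S.
Proof. by have /barrierP[_ [_ d] _ _ _] := SY; move=> Yy; rewrite (disjointFl d). Qed.

Let case_nbr y x : y \in Y -> adj G y x -> (x \in S) || (x \in U).
Proof.
move=> Yy Gyx; case: (boolP (x \in S)) => //= nSx; apply/restP; split=> //.
  by have /andP[] := adj_vset Gyx.
by apply/negP => Yx; have := indY Yy Yx; rewrite Gyx.
Qed.

Let XP u : reflect (u \in U /\ exists2 y, y \in Y & adj G y u) (u \in X).
Proof.
rewrite [X in reflect _ X]in_set; apply: (iffP andP) => -[Uu]; first by move/exists_inP.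
by move=> H; split=> //; apply/exists_inP.
Qed.

Let par_uniq y u : y \in Y -> u \in U -> adj G y u -> par u = y.
Proof.
move=> Yy Uu Gyu; rewrite /par; case: pickP => [z /andP[Yz Gzu]|/(_ y)] /=.
  exact: contact_inj Gzu Gyu.
by rewrite Yy Gyu.
Qed.

Let parP u : u \in X -> par u \in Y /\ adj G (par u) u.
Proof. by case/XP => Uu [y Yy Gyu]; rewrite (par_uniq Yy). Qed.

Let X_Lo u : u \in X -> lab u \in Lo.
Proof. by case/XP => Uu [y Yy Gyu]; rewrite inE; exact: odd_class Gyu. Qed.

Let card_contacts l : #|[set u in X | lab u == l]| = cnt l.
Proof.
rewrite -(card_imset _ (_ : injective (fun u => (par u, u)))); last by move=> u v [].
congr #|pred_of_set _|; apply/setP => p; apply/imsetP/linksP => [[u]|].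
  rewrite in_set => /andP[Xu /eqP lu] ->; have [Yp Gp] := parP Xu.
  by split=> //; case/XP: Xu.
case: p => y u [/= Yy Uu Gyu lu]; exists u; last by rewrite (par_uniq Yy Uu Gyu).
by rewrite in_set lu eqxx andbT; apply/XP; split=> //; exists y.
Qed.

Let cnt_odd l : l \in Lo -> cnt l = (2 * K l).+1.
Proof. by rewrite inE => ol; rewrite -[LHS]odd_double_half ol mul2n. Qed.

Let cnt_even l : l \notin Lo -> cnt l = 0.
Proof.
move=> nLo; apply/eqP; rewrite -card_contacts cards_eq0; apply/eqP/setP => u.
rewrite in_set0 in_set; apply/negP => /andP[Xu /eqP lu].
by move: nLo; rewrite -lu X_Lo.
Qed.

Let sum_contacts (V : nmodType) (F : L -> V) :
  (\sum_(u in X) F (lab u) = \sum_(l in Lo) F l *+ cnt l)%R.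
Proof.
rewrite (partition_big lab (mem Lo)) => [|u]; last exact: X_Lo.
apply: eq_bigr => l _; rewrite -card_contacts -sumr_const.
by apply: eq_big => u; rewrite ?in_set // => /andP[_ /eqP->].
Qed.

Let card_X : #|X| = 2 * q + #|Lo|.
Proof.
rewrite -sum1_card (partition_big lab (mem Lo)) => [|u]; last exact: X_Lo.
rewrite big_distrr -sum1_card -big_split /=; apply: eq_bigr => l Ll.
rewrite addn1 -cnt_odd // -card_contacts -sum1_card.
by apply: eq_bigl => u; rewrite in_set.
Qed.

Let class_ge l : l \in Lo -> 2 * K l < #|cls l|.
Proof.
move=> Ll; rewrite -cnt_odd // -card_contacts; apply: subset_leq_card.
by apply/subsetP => u; rewrite !in_set => /andP[/andP[-> _] ->].
Qed.

Let deficit : #|S| + q < #|Y|.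
Proof.
have /barrierP[_ _ _ _] := SY; congr (_ + _ < _); rewrite (bigID (mem Lo)) /=.
by rewrite [X in _ + X]big1 ?addn0 // => l /cnt_even; rewrite /cnt => ->.
Qed.

Let tough_odd : 2 <= #|Lo| -> 3 * #|Lo| <= 2 * (#|S| + #|Y|).
Proof.
move=> le2; have sub : Lo \subset lab @: (A :\: (S :|: Y)).
  apply/subsetP => l Ll; have /card_gt0P[u] : 0 < #|cls l|.
    by apply: leq_trans (class_ge Ll).
  by rewrite in_set => /andP[Uu /eqP <-]; exact: imset_f.
have leL := subset_leq_card sub.
have := tough_labels toughG (_ : S :|: Y \subset A) _ (leq_trans le2 leL).
rewrite subUset sSA sYA => /(_ isT) H; have le_S : #|S :|: Y| <= #|S| + #|Y|.
  by rewrite leq_card_setU.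
rewrite (leq_trans (leq_mul (leqnn 3) leL)) //; apply: leq_trans (leq_mul (leqnn 2) le_S).
by apply: H; have /barrierP[] := SY.
Qed.

(** If [|Y| = 1], then [S] is empty by [deficit], and the neighbors of [y], at least two, lie in
    different odd classes. Deleting one vertex would then leave at least two components. *)
Let two_Y : 1 < #|Y|.
Proof.
rewrite ltnNge; apply/negP => le1; have := deficit.
have /card_gt0P[y Yy] : 0 < #|Y| by apply: leq_ltn_trans deficit.
move=> def; have S0 : S = set0.
  by apply/eqP; rewrite -cards_eq0; move: def le1; clear; lia.
have := critical_min_degree crit toughG (subsetP sYA _ Yy).
have Unbr u : adj G y u -> u \in U.
  by move/(case_nbr Yy); rewrite S0 inE.
have -> : degree G y = #|lab @: [set u | adj G y u]|.
  by rewrite card_in_imset // => u v; rewrite !in_set => Gu Gv;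
     apply: (class_inj Yy) => //; exact: Unbr.
have sub : lab @: [set u | adj G y u] \subset Lo.
  apply/subsetP => l /imsetP[u]; rewrite in_set => Gu ->; rewrite in_set.
  by apply: (odd_class Yy) => //; exact: Unbr.
move=> lt2; have le2 := leq_trans lt2 (subset_leq_card sub).
by have := tough_odd le2; move: le1 le2; rewrite S0 cards0; clear; lia.
Qed.

(** The neighborhood of [y] separates it from a second vertex of [Y], so toughness gives
    [3 * 2 <= 2 * degree G y]. *)
Let degree_Y y : y \in Y -> 3 <= degree G y.
Proof.
move=> Yy; have /card_gt0P[z] : 0 < #|Y :\ y|.
  by have := two_Y; rewrite (cardsD1 y Y) Yy.
case/setD1P => nzy Yz; pose N := [set u | adj G y u].
have NA : N \subset A by apply/subsetP => u; rewrite inE => /adj_vset/andP[].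
pose f x := x == y; suff le2 : 2 <= #|f @: (A :\: N)|.
  have := tough_labels toughG NA _ le2; rewrite /degree -/N => H.
  suff : 3 * #|f @: (A :\: N)| <= 2 * #|N| by move: le2; clear; lia.
  apply: H => u v; rewrite !in_setD !in_set /f => /andP[nGu _] /andP[nGv _] Guv.
  have [uy|_] := eqVneq u y; first by move: nGv; rewrite -uy Guv.
  by apply/esym/negbTE; apply: contraNneq nGu => <-; rewrite adj_sym.
have -> : 2 = #|[set true; false]| by rewrite cards2.
apply: subset_leq_card; rewrite subUset !sub1set.
rewrite -{1}(eqxx y) -(negbTE nzy) !(imset_f f) // in_setD in_set ?(subsetP sYA) ?andbT //.
  exact: indY.
by rewrite adj_irrefl.
Qed.

(* Deleting [S] and all contacts but one in every odd class leaves each vertex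
   of [Y] in a component of its own. *)
Let tough_contacts : 3 * #|Y| <= 2 * (#|S| + 2 * q).
Proof.
have /card_gt0P[v0 Yv0] : 0 < #|Y| by apply: ltnW two_Y.
pose rep l := odflt v0 [pick u in X | lab u == l].
have repP l : l \in Lo -> rep l \in X /\ lab (rep l) = l.
  move=> Ll; rewrite /rep; case: pickP => [u /andP[Xu /eqP lu] //|no].
  have : 0 < #|[set u in X | lab u == l]| by rewrite card_contacts cnt_odd.
  by case/card_gt0P => u; rewrite in_set no.
pose X' := X :\: (rep @: Lo).
have cX' : #|X'| = 2 * q.
  have sub : rep @: Lo \subset X by apply/subsetP => u /imsetP[l /repP[Xl _] ->].
  rewrite cardsDS // card_X card_in_imset ?addnK // => l l' /repP[_ E] /repP[_ E'] rE.
  by rewrite -E rE.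
pose f v := if v \in Y then v else if lab v \in Lo then par (rep (lab v)) else v0.
have sW : S :|: X' \subset A.
  rewrite subUset sSA; apply/subsetP => u /setDP[/XP[/restP[]] //].
have inW v : v \in A :\: (S :|: X') -> v \in Y \/ v \in U /\ (v \in X -> v = rep (lab v)).
  rewrite in_setD in_setU negb_or -andbA => /and3P[nS nX' Av].
  have [Yv|nYv] := boolP (v \in Y); [by left|right].
  split=> [|Xv]; first by apply/restP.
  move: nX'; rewrite in_setD Xv andbT negbK => /imsetP[l /repP[_ lE] vE].
  by rewrite {2}vE lE.
have fYU y u : y \in Y -> u \in U -> (u \in X -> u = rep (lab u)) -> adj G y u -> f y = f u.
  move=> Yy Uu uE Gyu; have Xu : u \in X by apply/XP; split=> //; exists y.
  have /restP[_ _ nYu] := Uu; rewrite /f Yy (negbTE nYu) X_Lo // -uE //.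
  by rewrite (par_uniq Yy Uu).
have f_adj : {in A :\: (S :|: X') &, forall x y, adj G x y -> f x = f y}.
  move=> u v /inW[Yu|[Uu uE]] /inW[Yv|[Uv vE]] Guv.
  - by have := indY Yu Yv; rewrite Guv.
  - exact: fYU.
  - by apply/esym/fYU; rewrite 1?adj_sym.
  have /barrierP[_ _ _ lab_e _] := SY.
  have [/restP[_ _ nYu] /restP[_ _ nYv]] := (Uu, Uv).
  by rewrite /f (negbTE nYu) (negbTE nYv) (lab_e u v).
have sub : Y \subset f @: (A :\: (S :|: X')).
  apply/subsetP => y Yy; apply/imsetP; exists y; last by rewrite /f Yy.
  rewrite in_setD in_setU negb_or dSY // (subsetP sYA) // andbT /=.
  by apply/negP => /setDP[/XP[/restP[_ _]]]; rewrite Yy.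
have leY := subset_leq_card sub.
have := tough_labels toughG sW f_adj (leq_trans two_Y leY) => le.
have leW : #|S :|: X'| <= #|S| + 2 * q by rewrite -cX' leq_card_setU.
rewrite (leq_trans (leq_mul (leqnn 3) leY)) // (leq_trans le) //.
by rewrite leq_mul2l.
Qed.

Let order_ge : #|S| + #|Y| + \sum_(l in Lo) #|cls l| <= #|A|.
Proof.
have -> : #|A| = #|S| + #|Y| + #|U|.
  have sSYA : S :|: Y \subset A by rewrite subUset sSA.
  rewrite -(cardsID (S :|: Y) A) (setIidPr sSYA) -(cardsUI S Y).
  have -> : S :&: Y = set0.
    by apply/eqP; have /barrierP[_ [_ d] _ _ _] := SY; rewrite setI_eq0.
  by rewrite cards0 addn0.
rewrite leq_add2l -[#|U|]sum1_card (partition_big lab predT) //=.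
rewrite [leqRHS](bigID (mem Lo)) /= (leq_trans _ (leq_addr _ _)) //.
apply: leq_sum => l _; rewrite -sum1_card; apply: eq_leq; apply: eq_bigl => u.
by rewrite in_set.
Qed.

(** The neighbors of [u] lie in [S], in its class, or are [par u], which takes the place of [u]
    itself in the count of the class. *)
Let degree_contact u : u \in X -> k.+2 <= degree G (par u) + (#|S| + #|cls (lab u)|).
Proof.
move=> Xu; have [Yp Gp] := parP Xu; have /XP[Uu _] := Xu.
apply: leq_trans (critical_degree_sum crit Gp) _; rewrite leq_add2l.
have sub : [set v | adj G u v] \subset S :|: (par u |: (cls (lab u) :\ u)).
  apply/subsetP => v; rewrite in_set => Guv; have Gvu : adj G v u by rewrite adj_sym.
  have /andP[_ Av] := adj_vset Guv.
  rewrite in_setU in_setU1 in_setD1 in_set; case: (boolP (v \in S)) => //= nSv.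
  have [Yv|nYv] := boolP (v \in Y); first by rewrite (par_uniq Yv Uu Gvu) eqxx.
  have Uv : v \in U by apply/restP.
  have /barrierP[_ _ _ lab_e _] := SY.
  rewrite Uv (lab_e v u) // eqxx !andbT.
  by rewrite (_ : v != u) ?orbT //; apply: contraTneq Guv => ->; rewrite adj_irrefl.
apply: leq_trans (subset_leq_card sub) _; apply: leq_trans (leq_card_setU _ _) _.
have clsu : u \in cls (lab u) by rewrite in_set Uu eqxx.
rewrite leq_add2l cardsU1 [leqRHS](cardsD1 u) clsu leq_add2r.
by case: (_ \in _).
Qed.

Let D := [set y in Y | degree G y == k].

(** Different vertices of [D] have different contacts, so [|D| * (k - s) <= 2 * q + h]. The right
    side is at most [3 * k - s - t], which is less than [3 * (k - s)]. *)
Let few_max : #|D| <= 2.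
Proof.
have le_sum : #|D| * k <= #|D| * #|S| + #|X|.
  have lhs : #|D| * k <= \sum_(y in D) (#|S| + #|[set u in U | adj G y u]|).
    rewrite -sum_nat_const; apply: leq_sum => y; rewrite in_set => /andP[Yy /eqP <-].
    rewrite (leq_trans _ (leq_card_setU _ _)) //; apply: subset_leq_card.
    apply/subsetP => u; rewrite in_set => Gyu; rewrite in_setU in_set Gyu andbT.
    exact: case_nbr Gyu.
  apply: leq_trans lhs _; rewrite big_split /= sum_nat_const leq_add2l.
  have <- : \sum_(y in D) \sum_(u in U | adj G y u) 1 =
            \sum_(y in D) #|[set u in U | adj G y u]|.
    by apply: eq_bigr => y _; rewrite -sum1_card; apply: eq_bigl => u; rewrite in_set.
  rewrite (exchange_big_dep (mem U)) /= => [|y u _ /andP[] //].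
  rewrite -sum1_card big_mkcond [leqRHS]big_mkcond /=; apply: leq_sum => u _.
  case: ifP => // Uu; case: ifP => [Xu|nXu]; last first.
    rewrite big1 // => y /andP[]; rewrite in_set => /andP[Yy _] /andP[_ Gyu].
    by case/negP: nXu; apply/XP; split=> //; exists y.
  apply: (@leq_trans (\sum_(y | y == par u) 1)); last by rewrite big_pred1_eq.
  rewrite big_mkcond [leqRHS]big_mkcond; apply: leq_sum => y _ /=.
  case: ifP => // /andP[]; rewrite in_set => /andP[Yy _] /andP[_ Gyu].
  by rewrite (par_uniq Yy Uu Gyu) eqxx.
rewrite card_X in le_sum; have le_n := leq_trans order_ge order_le.
have le_N : 2 * q + #|Lo| <= \sum_(l in Lo) #|cls l|.
  rewrite big_distrr -sum1_card -big_split /=; apply: leq_sum => l /class_ge.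
  by rewrite addn1.
have arith (d s kk qq h N t : nat) : d * kk <= d * s + (2 * qq + h) -> 2 * qq + h <= N ->
  s + t + N <= 3 * kk -> s + qq < t -> 3 * t <= 2 * (s + 2 * qq) -> d <= 2.
  by clear; nia.
exact: arith le_sum le_N le_n deficit tough_contacts.
Qed.

Local Open Scope ring_scope.

Let wt y : rat := (degree G y)%:R^-1.

Let k_gt0 : (0 < k)%N.
Proof.
have /card_gt0P[y /degree_Y le3] : (0 < #|Y|)%N by apply: ltnW two_Y.
by apply: leq_trans (degree_le G y); apply: leq_trans le3.
Qed.

(** By [few_max], neighbors of degree [k] weigh at most [2 / k]. For [m] of smallest degree among
    the others, [B], Vizing's lemma provides at least [k + 1 - deg m] neighbors of degree [k]. So
    [|B| <= deg m - 1], and [B] weighs at most [1 - 1 / deg m <= 1 - 1 / k]. *)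
Let weight_S x : x \in S -> \sum_(y in Y | adj G y x) wt y <= 1 + k%:R^-1.
Proof.
move=> Sx; have k0 : 0 < k%:R :> rat by rewrite ltr0n.
have ki0 : 0 < (k%:R^-1 : rat) by rewrite invr_gt0.
have ki1 : (k%:R^-1 : rat) <= 1 by rewrite invf_le1 // ler1n.
rewrite (bigID (mem D)) /=.
have sumD : \sum_(y | (y \in Y) && adj G y x && (y \in D)) wt y <= 2 * k%:R^-1.
  apply: (@le_trans _ _ (\sum_(y in D) k%:R^-1)).
    rewrite big_mkcond [leRHS]big_mkcond; apply: ler_sum => y _ /=.
    case: ifP => [/andP[_ Dy]|_]; last by case: ifP => // _; exact: ltW.
    by rewrite Dy; move: Dy; rewrite in_set /wt => /andP[_ /eqP ->].
  rewrite sumr_const -[_^-1 *+ _]mulr_natl; apply: ler_wpM2r; first exact: ltW.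
  by rewrite (ler_nat _ _ 2) few_max.
pose B := [set y in Y | adj G y x & y \notin D].
have -> : \sum_(i | (i \in Y) && adj G i x && (i \notin D)) wt i = \sum_(y in B) wt y.
  by apply: eq_bigl => y; rewrite [RHS]in_set andbA.
have [B0|[y0 By0]] := set_0Vmem B; first by rewrite B0 big_set0; lra.
case: (@arg_minnP _ y0 (mem B) (degree G) By0) => m Bm min_m.
have := Bm; rewrite /= in_set => /and3P[Ym Gmx nDm].
have ltk : (degree G m < k)%N.
  by rewrite ltn_neqAle degree_le andbT; move: nDm; rewrite in_set Ym.
have leB : (#|B| < degree G m)%N.
  have Gxm : adj G x m by rewrite adj_sym.
  have := critical_adjacency crit Gxm; set Q := [set w | _].
  have dis : B :&: Q = set0.
    apply/setP => w; rewrite in_set0 in_setI !in_set; apply/negP.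
    case/andP => /and3P[Yw _ nDw] /and3P[_ _ dw].
    by move: nDw; rewrite Yw dw.
  have : (#|B| + #|Q| <= k)%N.
    rewrite -cardsUI dis cards0 addn0; apply: leq_trans (degree_le G x).
    apply: subset_leq_card; rewrite subUset; apply/andP; split; apply/subsetP => w.
      by rewrite !in_set => /and3P[_ Gwx _]; rewrite adj_sym.
    by rewrite !in_set => /and3P[].
  by clear; lia.
have m0 : 0 < (degree G m)%:R :> rat by rewrite ltr0n (leq_ltn_trans _ leB).
have sumB : \sum_(y in B) wt y <= #|B|%:R * (degree G m)%:R^-1.
  rewrite mulr_natl -sumr_const; apply: ler_sum => y By.
  by rewrite /wt lef_pV2 ?posrE ?ler_nat ?min_m // (lt_le_trans m0) // ler_nat min_m.
have {}sumB : \sum_(y in B) wt y <= 1 - (degree G m)%:R^-1.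
  apply: le_trans sumB _; rewrite lerBrDr -{2}[_^-1]mul1r -mulrDl.
  by rewrite ler_pdivrMr // mul1r natr1 ler_nat.
have : (k%:R^-1 : rat) <= (degree G m)%:R^-1 by rewrite lef_pV2 ?posrE // ler_nat ltnW.
by lra.
Qed.

Let M : rat := k%:R - #|S|%:R + 1.

Let M_gt0 : 0 < M.
Proof.
have le_n := leq_trans order_ge order_le; rewrite /M ltr_wpDl // subr_ge0 ler_nat.
by move: le_n deficit tough_contacts; clear; lia.
Qed.

(** For a class of size [c], [degree_contact] bounds the weight by [1 / (M + 1 - c)], convex in [c].
    The second term is the chord from [c = 1] to [c = M - 2], where the bound 1/3 from [degree_Y] is
    reached. *)
Let g l : rat := Num.min (1 / 3) (((#|cls l|)%:R + 2) / (3 * M)).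

Let weight_contact u : u \in X -> wt (par u) <= g (lab u).
Proof.
move=> Xu; have [Yp Gp] := parP Xu; have /XP[Uu _] := Xu; rewrite /wt /g.
have d3 : 3 <= (degree G (par u))%:R :> rat by rewrite (ler_nat _ 3) degree_Y.
have d0 : 0 < (degree G (par u))%:R :> rat by lra.
have u1 : 1 <= #|cls (lab u)|%:R :> rat.
  by rewrite ler1n; apply/card_gt0P; exists u; rewrite in_set Uu eqxx.
have := degree_contact Xu; rewrite -(ler_nat rat) -addn2 !natrD.
set d := (degree G _)%:R in d3 d0 *; set c := #|cls _|%:R in u1 * => sum_ge.
have {}sum_ge : M + 1 <= d + c by rewrite /M; lra.
have M3 : 0 < 3 * M by have := M_gt0; lra.
rewrite le_min; apply/andP; split.
  by rewrite -[d^-1]mul1r ler_pdivrMr //; lra.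
rewrite ler_pdivlMr // mulrC ler_pdivrMr //.
(* From [c = M - 2] on, degree 3 suffices. Below, [(c + 2) * (M + 1 - c) - 3 * M] equals
   [(c - 1) * (M - 2 - c)]. *)
have [le_M|lt_M] := lerP M (c + 2); first by nra.
have : 0 <= (c - 1) * (M - 2 - c) by apply: mulr_ge0; lra.
have : 0 <= (c + 2) * (d + c - M - 1) by apply: mulr_ge0; lra.
by lra.
Qed.

Let weight_vertex x : \sum_(y in Y | adj G y x) wt y <=
  (if x \in S then 1 + k%:R^-1 else 0) + (if x \in X then g (lab x) else 0).
Proof.
have g0 l : 0 <= g l.
  by rewrite le_min; apply/andP; split; rewrite ?divr_ge0 ?addr_ge0 ?mulr_ge0 ?(ltW M_gt0).
case: ifP => [Sx|nSx].
  by apply: le_trans (weight_S Sx) _; rewrite lerDl; case: ifP.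
rewrite add0r; case: ifPn => [Xx|nXx].
  have [Yp Gp] := parP Xx; have /XP[Ux _] := Xx.
  rewrite (eq_bigl (pred1 (par x))) ?big_pred1_eq ?weight_contact // => y /=.
  apply/andP/eqP => [[Yy Gyx]|->//]; by rewrite (par_uniq Yy Ux Gyx).
rewrite big_pred0 // => y; apply/andP => -[Yy Gyx].
have := case_nbr Yy Gyx; rewrite nSx /= => Ux.
by case/negP: nXx; apply/XP; split=> //; exists y.
Qed.

(** The weights add up to less than [s + 3/5 + q + 2/5], while [deficit] asks for at least
    [s + q + 1]. *)
Lemma tight_barrier_absurd : False.
Proof.
have k0 : 0 < k%:R :> rat by rewrite ltr0n.
have sumY : #|Y|%:R = \sum_(y in Y) \sum_(x | adj G y x) wt y.
  rewrite -sumr_const; apply: eq_bigr => y Yy; rewrite sumr_const /wt.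
  have -> : #|adj G y| = degree G y by apply: eq_card => x; rewrite in_set.
  by rewrite -[RHS]mulr_natr mulVf // pnatr_eq0 -lt0n (leq_trans _ (degree_Y Yy)).
have le_sum : #|Y|%:R <= #|S|%:R * (1 + k%:R^-1) + \sum_(l in Lo) (2 * (K l)%:R + 1) * g l.
  rewrite sumY (exchange_big_dep predT) //=.
  apply: (le_trans (ler_sum _ (fun x _ => weight_vertex x))).
  rewrite big_split /= -!big_mkcond /= sumr_const sum_contacts mulr_natl lerD2l.
  apply: ler_sum => l Ll; rewrite cnt_odd // -[_ *+ _]mulr_natl -addn1 natrD natrM.
  exact: lexx.
have le_n := leq_trans order_ge order_le.
have := @weight_bound L Lo K (fun l => #|cls l|) g #|S| #|Y| q #|Lo| k erefl erefl
  class_ge deficit tough_contacts tough_odd le_n.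
have gP l : l \in Lo -> [/\ 0 <= g l, 3 * g l <= 1 &
    3 * (k%:R - #|S|%:R + 1) * g l <= (#|cls l|)%:R + 2].
  move=> _; have M0 := M_gt0; rewrite -/M; split.
  - rewrite le_min; apply/andP; split; first by lra.
    by apply: divr_ge0; [apply: addr_ge0|lra].
  - have : g l <= 1 / 3 by rewrite ge_min lexx.
    by lra.
  - rewrite mulrC -ler_pdivlMr; last by lra.
    by rewrite ge_min lexx orbT.
move=> /(_ gP) le_w.
(* Of the [3 * k] vertices available, [Y] takes at least [2 * s + 4] and the odd classes at least
   [2 * q >= 2 * s + 6]. *)
have S_le : 5 * #|S|%:R + 10 <= 3 * k%:R :> rat.
  have le_N : (2 * q + #|Lo| <= \sum_(l in Lo) #|cls l|)%N.
    rewrite big_distrr -sum1_card -big_split /=; apply: leq_sum => l /class_ge.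
    by rewrite addn1.
  have arith (s t N qq h kk : nat) : (s + t + N <= 3 * kk)%N -> (2 * qq + h <= N)%N ->
    (s + qq < t)%N -> (3 * t <= 2 * (s + 2 * qq))%N -> (5 * s + 10 <= 3 * kk)%N.
    by clear; lia.
  have := arith _ _ _ _ _ _ le_n le_N deficit tough_contacts.
  by rewrite -(ler_nat rat) !(natrD, natrM).
have Sk : #|S|%:R * k%:R^-1 < 3 / 5 :> rat.
  by rewrite ltr_pdivrMr //; lra.
move: deficit le_sum le_w Sk; rewrite -(ler_nat rat) -addn1 !natrD mulrDr mulr1; lra.
Qed.

End TightCounting.

(** * The 2-factor as a subgraph, and the conclusion *)

Lemma two_factor_of_rel (T : finType) (G : sgraph T) (F : rel T) :
  subrel F (adj G) -> symmetric F -> {in vset G, forall x, #|[set y | F x y]| = 2} ->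
  exists H : sgraph T, two_factor H G.
Proof.
move=> FG Fs F2; pose E := [set [set p.1; p.2] | p in [set p : T * T | F p.1 p.2]].
have EG : E \subset edges G.
  by apply/subsetP => s /imsetP[p]; rewrite in_set => /FG Gp ->.
have wf : [forall s in E, (#|s| == 2) && (s \subset vset G)].
  by apply/forall_inP => s /(subsetP EG) Gs; have /forall_inP/(_ s Gs) := edges_wf G.
exists (SGraph wf); split=> // [|x Ax]; first by rewrite /subgraph subxx.
rewrite -(F2 x Ax) /degree; congr #|pred_of_set _|; apply/setP => y; rewrite !in_set.
apply/imsetP/idP => [[[a b]]|Fxy]; last by exists (x, y); rewrite ?in_set.
rewrite in_set /= => Fab E2.
have : x \in [set a; b] by rewrite -E2 set21.
case/set2P => xE; subst x.
  by have /eqP := E2; rewrite set2_eq => /eqP ->.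
have /eqP : [set b; y] = [set b; a] by rewrite E2 setUC.
by rewrite set2_eq => /eqP ->; rewrite Fs.
Qed.

Local Open Scope ring_scope.

Theorem theorem1p3 (R : realType) (T : finType) (G : sgraph T) :
  Delta_critical G ->
  ((3 / 2 : R)%:E <= toughness R G)%E ->
  #|vset G|%:R / 3 <= (max_degree G)%:R :> R ->
  exists H : sgraph T, two_factor H G.
Proof.
move=> crit toughG le_deg.
have order_le : (#|vset G| <= 3 * max_degree G)%N.
  by move: le_deg; rewrite ler_pdivrMr // mulrC -natrM ler_nat.
have [[F [FG Fs F2]]|[S0 [Y0 [lab0 b0]]]] := @two_factor_or_barrier _ (adj G) (vset G)
    (adj_sym G) (@adj_irrefl _ G) (fun x y Gxy => proj1 (andP (adj_vset Gxy))).
  exact: two_factor_of_rel FG Fs F2.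
have [S [Y [lab [b odd_class class_inj contact_inj]]]] :=
  tight_barrier (adj_sym G) b0.
by case: (tight_barrier_absurd crit toughG order_le b odd_class class_inj contact_inj).
Qed.
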